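(* Let $M>0$ and $a,b\ge 0$ be real numbers. Let $\mathbf{X}=(X_1,\dots,X_n)$ be a vector of independent random variables, each taking values in the (measurable) set $\mathcal{X}$, and let $f:\mathcal{X}^n\to\mathbb{R}$ be a non-negative, $(M,a,b)$ self-bounding, measurable function such that $Z=f(\mathbf{X})$ has finite mean. Define (the first applicable case being used) $$\delta(a,M)_+=\begin{cases}0, & a\le \frac13,\\ a-\frac13, & \frac12<M\le 1,\\ a-\frac13, & M>1\ \text{and}\ a<\frac{M}{3(M-1)},\\ a, & \text{otherwise,}\end{cases}\qquad \delta(a,M)_-=\begin{cases}0, & a\ge\frac13,\\ a, & \text{otherwise.}\end{cases}$$ Then the following hold: (a) For all $t>0$, $$\mathbb{P}(Z-\mathbb{E}[Z]\ge t)\le \exp\left(-\frac{1}{M}\,\frac{t^2}{2(a\,\mathbb{E}[Z]+b)+\delta(a,M)_+\,t}\right).$$ (b) For all $0<t\le \mathbb{E}[Z]$, $$\mathbb{P}(Z-\mathbb{E}[Z]\le -t)\le \exp\left(-\frac{1}{M}\,\frac{t^2}{2(a\,\mathbb{E}[Z]+b)+\delta(a,M)_-\,t}\right).$$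
   Context: For $\mathbf{x}=(x_1,\dots,x_n)\in\mathcal{X}^n$ and $i\in\{1,\dots,n\}$ write $\mathbf{x}^{(i)}=(x_1,\dots,x_{i-1},x_{i+1},\dots,x_n)$, and for $f:\mathcal{X}^n\to\mathbb{R}$ define $$f_i(\mathbf{x}^{(i)})=\inf_{x_i'\in\mathcal{X}} f(x_1,\dots,x_{i-1},x_i',x_{i+1},\dots,x_n).$$ It is assumed throughout that each $f_i$ is measurable (with respect to the product $\sigma$-algebra on the remaining $n-1$ coordinates). Definition. The function $f$ is $(M,a,b)$ self-bounding if for every $\mathbf{x}\in\mathcal{X}^n$ and every $i=1,\dots,n$, $$0\le f(\mathbf{x})-f_i(\mathbf{x}^{(i)})\le M,\qquad\text{and}\qquad \sum_{i=1}^n\big(f(\mathbf{x})-f_i(\mathbf{x}^{(i)})\big)\le a f(\mathbf{x})+b.$$ Convention: if the denominator in one of the exponents equals $0$, the exponential bound is read as $0$. *)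

(* Defs.v *)
From mathcomp Require Import all_boot all_order all_algebra.
From mathcomp Require Import all_classical all_reals all_analysis.

Set Implicit Arguments.
Unset Strict Implicit.
Unset Printing Implicit Defensive.

Import Order.TTheory GRing.Theory Num.Theory.

Local Open Scope classical_set_scope.
Local Open Scope ring_scope.

(* The type [n.-tuple X] carries the product sigma-algebra of the library,
   generated by the coordinate maps [tnth ^~ i].  [omit_coord i x] is x with
   its i-th coordinate deleted; [insert_coord i y x'] is y with x' inserted at
   position i.  Both make sense for every n, since an index i : 'I_n forces
   n > 0. *)
Definition omit_coord (X : Type) (n : nat) (i : 'I_n) (x : n.-tuple X) :
    n.-1.-tuple X :=
  [tuple tnth x (lift i j) | j < n.-1].

Definition insert_coord (X : Type) (n : nat) (i : 'I_n) (y : n.-1.-tuple X)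
    (x' : X) : n.-tuple X :=
  [tuple if unlift i j is Some k then tnth y k else x' | j < n].

(* The infimum is the real-valued [inf], which is the true infimum as soon as
   f is bounded below, in particular for nonnegative f. *)
Definition coord_inf (R : realType) (X : Type) (n : nat) (f : n.-tuple X -> R)
    (i : 'I_n) (y : n.-1.-tuple X) : R :=
  inf [set f (insert_coord i y x') | x' in [set: X]].

Definition self_bounding (R : realType) (X : Type) (n : nat) (M a b : R)
    (f : n.-tuple X -> R) : Prop :=
  forall x : n.-tuple X,
    (forall i : 'I_n, 0 <= f x - coord_inf f i (omit_coord i x) <= M) /\
    \sum_(i < n) (f x - coord_inf f i (omit_coord i x)) <= a * f x + b.

Definition mutually_independent (R : realType) (dO : measure_display)
    (Omega : measurableType dO) (P : probability Omega R)
    (dX : measure_display) (X : measurableType dX) (n : nat)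
    (V : 'I_n -> {RV P >-> X}) : Prop :=
  forall (J : {set 'I_n}) (A : 'I_n -> set X),
    (forall i, measurable (A i)) ->
    P [set w | forall i, i \in J -> A i (V i w)] =
    (\prod_(i in J) P (V i @^-1` A i))%E.

Definition delta_plus (R : realType) (a M : R) : R :=
  if a <= 3^-1 then 0
  else if 2^-1 < M <= 1 then a - 3^-1
  else if (1 < M) && (a < M / (3 * (M - 1))) then a - 3^-1
  else a.

Definition delta_minus (R : realType) (a : R) : R :=
  if 3^-1 <= a then 0 else a.

(* exp (- (1 / M) * (t ^ 2 / den)), read as 0 when den = 0; without the case
   distinction the convention x / 0 = 0 would give 1. *)
Definition exp_bound (R : realType) (M t den : R) : R :=
  if den == 0 then 0 else expR (- (1 / M) * (t ^+ 2 / den)).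

(* Main.v *)
From HB Require Import structures.
Require Import Defs.
From mathcomp Require Import all_boot all_order all_algebra.
From mathcomp Require Import all_classical all_reals all_analysis.
From mathcomp Require Import measurable_realfun ring lra.

(** Replacing [f] by [f / M] and [b] by [b / M] turns both bounds into bounds
    for [M = 1]. There the proof gives more than is claimed: writing
    [v = a * E Z + b], the coefficient of [t] in the upper tail is
    [Num.max 0 (a - 1/3)], which [delta_plus] dominates, and it is [0] in the
    lower tail. Both tails follow from Chernoff's bound once the Laplace
    transform of [Z] is controlled; bounded variation in each coordinate makes
    [f] bounded, so all moments exist. Write [Di] for the difference of [f] and
    its infimum over coordinate [i].

    Independence is used through partial means: [partial_mean nu S h] averages
    [h] over the coordinates outside [S], and removing [i] from [S] is
    invisible to test functions not depending on coordinate [i]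
    ([mean_partial_meanD1]). The infimum over coordinate [i] is such a function.

    Upper tail. The entropy of [expR (lam * f)] is split along the coordinates
    ([entropy_tensorization]); since the [Di] lie in [0, 1] and add up to at
    most [a * f + b], this yields, for the logarithm [G] of the centered
    Laplace transform and [psi = expR (- lam) - 1 + lam], the inequality
    [(lam - a * psi) * G' - G <= v * psi] ([entropy_self_bounding]). The function
    [v * lam ^+ 2 / (2 * (1 - c * lam))], [c] being half the coefficient above,
    is a supersolution ([supersolution], from
    [psi * (2 + 2/3 * lam) <= lam ^+ 2]) and so dominates [G]
    ([comparison_at0], [laplace_upper]).

    Lower tail. For small [a] the entropy method is too weak: it replaces
    [lam ^+ 2 / 2] by the larger [expR lam - 1 - lam]. Instead, let [Q] be the
    law with density proportional to [h = expR (- lam * f)], and interpolate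
    between the product law and [Q] by keeping each coordinate of a [Q]-sample
    with probability [r] and redrawing it otherwise. By Russo's formula
    ([is_derive_sum_subset_weight]) the mean of [a * f + b] under the
    interpolation has as derivative a sum over coordinates of mean effects of
    keeping coordinate [i]. Changing one coordinate multiplies [h] by at most
    [expR lam], so the decrease due to coordinate [i] is at most [a * k r]
    times the mean of [Di] under the same interpolation, where
    [k r = (expR lam - 1) / (r + (1 - r) * expR lam)]. Summing over [i] gives a
    linear differential inequality for the mean of [a * f + b], and [k] has
    integral [lam] over [0, 1]; so [Q] gives [a * f + b] a mean of at least
    [expR (- (a * lam)) * v] ([laplace_lower_affine]). Hence tilting by [h]
    lowers the mean of [f] by at most [lam * v], and integrating over [lam]
    bounds the logarithm of the centered Laplace transform at [- lam] by
    [v * lam ^+ 2 / 2] ([laplace_lower]). *)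

Set Implicit Arguments.
Unset Strict Implicit.
Unset Printing Implicit Defensive.

Import Order.TTheory GRing.Theory Num.Theory.
Import numFieldNormedType.Exports.

Local Open Scope classical_set_scope.
Local Open Scope ring_scope.

(** * Derivatives of real functions in applied form *)

Section is_derive_applied.
Context {R : realType}.
Implicit Types (f g : R -> R) (x : R).

Lemma is_derive_addf f g x df dg : is_derive x 1 f df -> is_derive x 1 g dg ->
  is_derive x 1 (fun y => f y + g y) (df + dg).
Proof. exact: is_deriveD. Qed.

Lemma is_derive_subf f g x df dg : is_derive x 1 f df -> is_derive x 1 g dg ->
  is_derive x 1 (fun y => f y - g y) (df - dg).
Proof. exact: is_deriveB. Qed.

Lemma is_derive_mulf f g x df dg : is_derive x 1 f df -> is_derive x 1 g dg ->
  is_derive x 1 (fun y => f y * g y) (df * g x + f x * dg).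
Proof.
move=> hf hg; apply: (@is_derive_eq _ _ _ (f * g)).
by rewrite /GRing.scale /= addrC [X in X + _]mulrC.
Qed.

Lemma is_derive_cstf (c x : R) : is_derive x 1 (fun=> c) 0.
Proof. exact: is_derive_cst. Qed.

Lemma is_derive_idf x : is_derive x 1 (fun y => y) 1.
Proof. exact: is_derive_id. Qed.

Lemma is_derive_scalef (c : R) f x df : is_derive x 1 f df ->
  is_derive x 1 (fun y => c * f y) (c * df).
Proof.
move=> hf; apply: is_derive_eq (is_derive_mulf (is_derive_cstf c x) hf) _.
by rewrite mul0r add0r.
Qed.

Lemma is_derive_oppf f x df : is_derive x 1 f df ->
  is_derive x 1 (fun y => - f y) (- df).
Proof. exact: is_deriveN. Qed.

Lemma is_derive_powf f n x df : is_derive x 1 f df ->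
  is_derive x 1 (fun y => f y ^+ n) (n%:R * f x ^+ n.-1 * df).
Proof.
move=> hf; rewrite -(_ : f ^+ n = fun y => f y ^+ n); last first.
  by apply/funext => y; elim: n => // n IH; rewrite !exprS -IH.
exact: is_deriveX.
Qed.

Lemma is_derive_sumf (I : finType) (f : I -> R -> R) (df : I -> R) x :
  (forall i, is_derive x 1 (f i) (df i)) ->
  is_derive x 1 (fun y => \sum_i f i y) (\sum_i df i).
Proof.
move=> hf; elim: (index_enum I) => [|i s IH].
  by rewrite big_nil; under eq_fun do rewrite big_nil; exact: is_derive_cstf.
by rewrite big_cons; under eq_fun do rewrite big_cons; exact: is_derive_addf.
Qed.

Lemma is_derive_expRf f x df : is_derive x 1 f df ->
  is_derive x 1 (fun y => expR (f y)) (expR (f x) * df).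
Proof. by move=> hf; apply: is_derive1_comp. Qed.

Lemma is_derive_lnf f x df : 0 < f x -> is_derive x 1 f df ->
  is_derive x 1 (fun y => ln (f y)) ((f x)^-1 * df).
Proof.
move=> fx0 hf; apply: is_derive1_comp; exact: is_derive1_ln.
Qed.

Lemma is_derive_invf f x df : f x != 0 -> is_derive x 1 f df ->
  is_derive x 1 (fun y => (f y)^-1) (- df / f x ^+ 2).
Proof.
move=> fx0 hf; apply: DeriveDef; first by apply: derivableV.
rewrite deriveV//.
by rewrite derive_val /GRing.scale /= !mulNr mulrC.
Qed.

Lemma is_derive_ge0_le f df a b : a <= b ->
  (forall x, a <= x <= b -> is_derive x 1 f (df x)) ->
  (forall x, a <= x <= b -> 0 <= df x) -> f a <= f b.
Proof.
move=> ab hf df0.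
have sub x : x \in `]a, b[ -> a <= x <= b.
  by rewrite in_itv /= => /andP[ax xb]; rewrite !ltW.
apply: (@ger0_derive1_ndecr _ f a b) => // [x /sub /hf hx|x /sub xab|].
- exact: ex_derive.
- by have := hf x xab => hx; rewrite derive1E derive_val; exact: df0.
- apply: derivable_within_continuous => x; rewrite in_itv /= => /hf hx.
  exact: ex_derive.
Qed.

End is_derive_applied.

(** * Bounded measurable functions and their integrals *)

(** A class on which every integral against a probability is finite and
    Fubini's theorem applies. Self-bounding functions belong to it, because
    their variation in each of finitely many coordinates is bounded. *)
Definition bounded_mfun (R : realType) d (T : measurableType d) (F : T -> R) : Prop :=
  measurable_fun [set: T] F /\ exists B, forall x, `|F x| <= B.

Section bounded_mfun.
Context {R : realType} {d : measure_display} {T : measurableType d}.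
Implicit Types (F G : T -> R) (P : probability T R).

Lemma bounded_mfun_cst (c : R) : bounded_mfun (fun _ : T => c).
Proof. by split; [exact: measurable_cst|exists `|c|]. Qed.

Lemma bounded_mfunD F G :
  bounded_mfun F -> bounded_mfun G -> bounded_mfun (fun x => F x + G x).
Proof.
move=> [mF [B FB]] [mG [C GC]]; split; first exact: measurable_funD.
by exists (B + C) => x; rewrite (le_trans (ler_normD _ _))// lerD.
Qed.

Lemma bounded_mfunM F G :
  bounded_mfun F -> bounded_mfun G -> bounded_mfun (fun x => F x * G x).
Proof.
move=> [mF [B FB]] [mG [C GC]]; split; first exact: measurable_funM.
by exists (B * C) => x; rewrite normrM ler_pM.
Qed.

Lemma bounded_mfunZ c F : bounded_mfun F -> bounded_mfun (fun x => c * F x).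
Proof. by move=> bF; apply: bounded_mfunM => //; exact: bounded_mfun_cst. Qed.

Lemma bounded_mfunB F G :
  bounded_mfun F -> bounded_mfun G -> bounded_mfun (fun x => F x - G x).
Proof.
move=> [mF [B FB]] [mG [C GC]]; split; first exact: measurable_funB.
by exists (B + C) => x; rewrite (le_trans (ler_normB _ _))// lerD.
Qed.

Lemma bounded_mfun_sum (I : Type) (r : seq I) (p : pred I) (F : I -> T -> R) :
  (forall i, bounded_mfun (F i)) ->
  bounded_mfun (fun x => \sum_(i <- r | p i) F i x).
Proof.
move=> bF; elim: r => [|i r IH].
  by under eq_fun do rewrite big_nil; exact: bounded_mfun_cst.
under eq_fun do rewrite big_cons.
by case: (p i) => //; exact: bounded_mfunD.
Qed.

Lemma bounded_mfun_expR F : bounded_mfun F -> bounded_mfun (fun x => expR (F x)).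
Proof.
move=> [mF [B FB]]; split; first exact: measurableT_comp.
exists (expR B) => x; rewrite ger0_norm ?expR_ge0// ler_expR.
exact: le_trans (ler_norm _) (FB x).
Qed.

Lemma bounded_mfun_ln F c :
  0 < c -> (forall x, c <= F x) -> bounded_mfun F ->
  bounded_mfun (fun x => ln (F x)).
Proof.
move=> c0 cF [mF [B FB]]; split; first exact: measurableT_comp.
have F0 x : 0 < F x by exact: lt_le_trans (cF x).
exists (`|ln c| + `|ln B|) => x.
have FxB : F x <= B by exact: le_trans (ler_norm _) (FB x).
have B0 : 0 < B by exact: lt_le_trans (F0 x) FxB.
have h1 : ln c <= ln (F x) by rewrite ler_ln ?posrE.
have h2 : ln (F x) <= ln B by rewrite ler_ln ?posrE.
have h3 := ler_norm (ln B).
have h4 := ler_norm (- ln c); rewrite normrN in h4.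
have h5 := normr_ge0 (ln B); have h6 := normr_ge0 (ln c).
by rewrite ler_norml; apply/andP; split; lra.
Qed.

Lemma bounded_mfunV F c :
  0 < c -> (forall x, c <= F x) -> bounded_mfun F ->
  bounded_mfun (fun x => (F x)^-1).
Proof.
move=> c0 cF bF.
have -> : (fun x => (F x)^-1) = (fun x => expR (-1 * ln (F x))).
  apply/funext => x; have Fx0 : 0 < F x by exact: lt_le_trans (cF x).
  by rewrite mulN1r expRN lnK.
by apply/bounded_mfun_expR/bounded_mfunZ; exact: (bounded_mfun_ln c0).
Qed.

Lemma bounded_mfun_integrable P F :
  bounded_mfun F -> P.-integrable [set: T] (EFin \o F).
Proof.
move=> [mF [B FB]]; apply: measurable_bounded_integrable => //.
  by rewrite [ltLHS]probability_setT ltry.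
exists B; split; first exact: num_real.
by move=> r Br x _ /=; exact: le_trans (FB x) (ltW Br).
Qed.

Lemma meanD P F G : bounded_mfun F -> bounded_mfun G ->
  \int[P]_x (F x + G x) = \int[P]_x F x + \int[P]_x G x.
Proof. by move=> bF bG; apply: RintegralD => //; exact: bounded_mfun_integrable. Qed.

Lemma meanB P F G : bounded_mfun F -> bounded_mfun G ->
  \int[P]_x (F x - G x) = \int[P]_x F x - \int[P]_x G x.
Proof. by move=> bF bG; apply: RintegralB => //; exact: bounded_mfun_integrable. Qed.

Lemma meanZ P c F : bounded_mfun F ->
  \int[P]_x (c * F x) = c * \int[P]_x F x.
Proof. by move=> bF; apply: RintegralZl => //; exact: bounded_mfun_integrable. Qed.

Lemma mean_cst P (c : R) : \int[P]_(_ in [set: T]) c = c.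
Proof. by rewrite Rintegral_cst// [X in fine X]probability_setT mulr1. Qed.

Lemma eq_mean P F G : F =1 G -> \int[P]_x F x = \int[P]_x G x.
Proof. by move=> FG; apply: eq_Rintegral => x _; exact: FG. Qed.

Lemma le_mean P F G : bounded_mfun F -> bounded_mfun G ->
  (forall x, F x <= G x) -> \int[P]_x F x <= \int[P]_x G x.
Proof.
by move=> bF bG FG; apply: le_Rintegral => //; exact: bounded_mfun_integrable.
Qed.

Lemma mean_sum P (I : Type) (r : seq I) (p : pred I) (F : I -> T -> R) :
  (forall i, bounded_mfun (F i)) ->
  \int[P]_x (\sum_(i <- r | p i) F i x) = \sum_(i <- r | p i) \int[P]_x F i x.
Proof.
move=> bF; elim: r => [|i r IH].
  by rewrite big_nil; under eq_Rintegral do rewrite big_nil; rewrite mean_cst.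
under eq_Rintegral do rewrite big_cons.
rewrite big_cons; case: (p i) => //.
by rewrite meanD ?IH//; exact: bounded_mfun_sum.
Qed.

End bounded_mfun.

Lemma bounded_mfun_comp (R : realType) d d' (T : measurableType d)
    (U : measurableType d') (F : U -> R) (g : T -> U) :
  measurable_fun [set: T] g -> bounded_mfun F -> bounded_mfun (fun x => F (g x)).
Proof.
by move=> mg [mF [B FB]]; split; [exact: measurableT_comp|exists B].
Qed.

Section fubini_bounded.
Context {R : realType} {d d' : measure_display}.
Context {T : measurableType d} {U : measurableType d'}.
Variables (P : probability T R) (Q : probability U R).
Variable F : T * U -> R.
Hypothesis bF : bounded_mfun F.

Let section2 x : bounded_mfun (fun y => F (x, y)).
Proof. by apply: bounded_mfun_comp bF; exact: pair1_measurable. Qed.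

Let section1 y : bounded_mfun (fun x => F (x, y)).
Proof. by apply: bounded_mfun_comp bF; exact: pair2_measurable. Qed.

Let mean2E x : ((\int[Q]_y F (x, y))%:E = \int[Q]_y (F (x, y))%:E)%E.
Proof.
rewrite fineK//; apply: integrable_fin_num => //.
exact: (bounded_mfun_integrable Q (section2 x)).
Qed.

Let mean1E y : ((\int[P]_x F (x, y))%:E = \int[P]_x (F (x, y))%:E)%E.
Proof.
rewrite fineK//; apply: integrable_fin_num => //.
exact: (bounded_mfun_integrable P (section1 y)).
Qed.

Lemma bounded_mfun_mean2 : bounded_mfun (fun x => \int[Q]_y F (x, y)).
Proof.
have iF := bounded_mfun_integrable (P \x Q)%E bF.
split.
  apply/measurable_EFinP; apply: eq_measurable_fun (measurable_fubini_F iF).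
  by move=> x _; rewrite /= mean2E.
have [_ [B FB]] := bF; exists B => x.
apply: le_trans (le_normr_Rintegral _ _) _ => //.
  exact: bounded_mfun_integrable.
rewrite -[leRHS](mean_cst Q); apply: le_mean => //; last exact: bounded_mfun_cst.
have [mS [C SC]] := section2 x; split; first exact: measurableT_comp.
by exists C => y; rewrite normr_id.
Qed.

Lemma mean_swap :
  \int[P]_x \int[Q]_y F (x, y) = \int[Q]_y \int[P]_x F (x, y).
Proof.
have iF := bounded_mfun_integrable (P \x Q)%E bF.
have /= e := Fubini iF.
congr fine; transitivity (\int[P]_x \int[Q]_y (F (x, y))%:E)%E.
  by apply: eq_integral => x _; rewrite mean2E.
by rewrite e; apply: eq_integral => y _; rewrite mean1E.
Qed.

Lemma mean_prod :
  \int[P]_x \int[Q]_y F (x, y) = \int[(P \x Q)%E]_z F z.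
Proof.
have iF := bounded_mfun_integrable (P \x Q)%E bF.
rewrite /Rintegral; congr fine; rewrite -(integral12_prod_meas1 iF).
by apply: eq_integral => x _; rewrite mean2E.
Qed.

End fubini_bounded.

(** * Resampling one coordinate of a random tuple *)

Definition mix (X : Type) n (S : {set 'I_n}) (x y : n.-tuple X) : n.-tuple X :=
  [tuple if i \in S then tnth x i else tnth y i | i < n].

Definition agree_off (X : Type) n (i : 'I_n) (x y : n.-tuple X) : Prop :=
  forall j, j != i -> tnth x j = tnth y j.

Definition insensitive (X Y : Type) n (i : 'I_n) (g : n.-tuple X -> Y) : Prop :=
  forall x y, agree_off i x y -> g x = g y.

Section mix.
Context {X : Type} {n : nat}.
Implicit Types (S : {set 'I_n}) (x y z : n.-tuple X).

Lemma tnth_mix S x y i :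
  tnth (mix S x y) i = if i \in S then tnth x i else tnth y i.
Proof. by rewrite tnth_mktuple. Qed.

Lemma mix_setT x y : mix [set: 'I_n]%SET x y = x.
Proof. by apply: eq_from_tnth => i; rewrite tnth_mix finset.in_setT. Qed.

Lemma mix_set0 x y : mix finset.set0 x y = y.
Proof. by apply: eq_from_tnth => i; rewrite tnth_mix finset.in_set0. Qed.

Lemma agree_off_mix i x y : agree_off i (mix [set~ i]%SET x y) x.
Proof. by move=> j ji; rewrite tnth_mix finset.in_setC1 ji. Qed.

Lemma agree_off_mixD1 S i x y : agree_off i (mix (S :\ i)%SET x y) (mix S x y).
Proof. by move=> j ji; rewrite !tnth_mix finset.in_setD1 ji. Qed.

(** Both sides take their coordinate [i] from [z]. *)
Lemma mix_resample S i x y z : i \in S ->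
  mix S (mix [set~ i]%SET x z) y = mix (S :\ i)%SET x (mix [set~ i]%SET y z).
Proof.
move=> iS; apply: eq_from_tnth => j.
rewrite !tnth_mix finset.in_setD1 finset.in_setC1.
by have [->|ji] := eqVneq j i; rewrite ?iS.
Qed.

End mix.

Lemma measurable_mix d (X : measurableType d) n (S : {set 'I_n}) :
  measurable_fun [set: n.-tuple X * n.-tuple X] (fun z => mix S z.1 z.2).
Proof.
apply/measurable_fun_tnthP => i.
have -> : (@tnth n X ^~ i \o fun z : n.-tuple X * n.-tuple X => mix S z.1 z.2) =
   if i \in S then (@tnth n X ^~ i) \o fst else (@tnth n X ^~ i) \o snd.
  by apply/funext => z; rewrite /= tnth_mix; case: ifP.
by case: ifP => _; apply: measurableT_comp => //; exact: measurable_tnth.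
Qed.

(** The form in which independence enters the concentration argument:
    replacing one coordinate by that of an independent copy does not change
    the law. *)
Definition resampling_invariant (R : realType) d (X : measurableType d) n
    (nu : probability (n.-tuple X) R) : Prop :=
  forall (i : 'I_n) (F : n.-tuple X -> R), bounded_mfun F ->
  \int[nu]_x F x = \int[nu]_x \int[nu]_y F (mix [set~ i]%SET x y).

(** For a product law, the conditional expectation of [h] given the
    coordinates in [S]. *)
Definition partial_mean (R : realType) d (X : measurableType d) n
    (nu : probability (n.-tuple X) R) (S : {set 'I_n}) (h : n.-tuple X -> R)
    (x : n.-tuple X) : R :=
  \int[nu]_y h (mix S x y).

Section partial_mean.
Context {R : realType} {d : measure_display} {X : measurableType d} {n : nat}.
Variable nu : probability (n.-tuple X) R.
Implicit Types (S : {set 'I_n}) (g h : n.-tuple X -> R).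

Lemma bounded_mfun_mix S h x :
  bounded_mfun h -> bounded_mfun (fun y => h (mix S x y)).
Proof.
move=> bh; apply: (@bounded_mfun_comp _ _ _ _ _ (fun z => h (mix S z.1 z.2)) (pair x)).
  exact: pair1_measurable.
exact: bounded_mfun_comp (@measurable_mix _ _ _ S) bh.
Qed.

Lemma bounded_mfun_partial_mean S h :
  bounded_mfun h -> bounded_mfun (partial_mean nu S h).
Proof.
move=> bh.
exact: (bounded_mfun_mean2 nu nu (bounded_mfun_comp (@measurable_mix _ _ _ S) bh)).
Qed.

Lemma partial_mean_setT h : partial_mean nu [set: 'I_n]%SET h = h.
Proof.
by apply/funext => x; rewrite /partial_mean; under eq_mean do rewrite mix_setT;
  exact: mean_cst.
Qed.

Lemma partial_mean_set0 h x : partial_mean nu finset.set0 h x = \int[nu]_y h y.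
Proof. by rewrite /partial_mean; under eq_mean do rewrite mix_set0. Qed.

Lemma partial_mean_ge S h c : bounded_mfun h -> (forall x, c <= h x) ->
  forall x, c <= partial_mean nu S h x.
Proof.
move=> bh ch x; rewrite -[leLHS](mean_cst nu); apply: le_mean => //.
  exact: bounded_mfun_cst.
exact: bounded_mfun_mix.
Qed.

Lemma insensitive_partial_mean S i h :
  insensitive i (partial_mean nu (S :\ i)%SET h).
Proof.
move=> x y xy; apply: eq_mean => z; congr h; apply: eq_from_tnth => j.
rewrite !tnth_mix finset.in_setD1; case: ifP => // /andP[ji _]; exact: xy.
Qed.

Hypothesis nuR : resampling_invariant nu.

(** Averaging over the further coordinate [i] is invisible to a test function
    not depending on [i]: this is the tower property of conditional
    expectations, obtained by resampling coordinate [i] of the outer variable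
    on one side and of the inner variable on the other. *)
Lemma mean_partial_meanD1 S i g h : i \in S -> insensitive i g ->
  bounded_mfun g -> bounded_mfun h ->
  \int[nu]_x (g x * partial_mean nu (S :\ i)%SET h x) =
  \int[nu]_x (g x * partial_mean nu S h x).
Proof.
move=> iS gi bg bh.
pose K (z : n.-tuple X * n.-tuple X * n.-tuple X) :=
  g z.1.1 * h (mix (S :\ i)%SET z.1.1 (mix [set~ i]%SET z.1.2 z.2)).
have mfst2 : measurable_fun [set: n.-tuple X * n.-tuple X * n.-tuple X]
    (fun z => z.1.1) by exact: measurableT_comp.
have msnd2 : measurable_fun [set: n.-tuple X * n.-tuple X * n.-tuple X]
    (fun z => z.1.2) by exact: measurableT_comp.
have bK : bounded_mfun K.
  apply: bounded_mfunM; first exact: (bounded_mfun_comp mfst2 bg).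
  apply: (@bounded_mfun_comp _ _ _ _ _ h) => //.
  apply: (measurableT_comp (@measurable_mix _ X n (S :\ i)%SET)
    (g := fun z => (z.1.1, mix [set~ i]%SET z.1.2 z.2))).
  apply: measurable_fun_pair => //.
  apply: (measurableT_comp (@measurable_mix _ X n [set~ i]%SET)
    (g := fun z => (z.1.2, z.2))).
  exact: measurable_fun_pair.
have bGS (U : {set 'I_n}) : bounded_mfun (fun z : n.-tuple X * n.-tuple X =>
    g z.1 * h (mix U z.1 z.2)).
  apply: bounded_mfunM; first exact: (bounded_mfun_comp _ bg).
  exact: bounded_mfun_comp (@measurable_mix _ X n U) bh.
pose L z := \int[nu]_w K (z, w).
have bL : bounded_mfun L by exact: (bounded_mfun_mean2 (nu \x nu)%E nu bK).
transitivity (\int[nu]_x \int[nu]_y L (x, y)).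
  apply: eq_mean => x; rewrite /partial_mean -meanZ; last exact: bounded_mfun_mix.
  rewrite (nuR i); last by apply: bounded_mfunZ; exact: bounded_mfun_mix.
  exact: eq_mean.
rewrite (mean_swap nu nu bL).
transitivity (\int[nu]_y \int[nu]_x (g x * h (mix S x y))).
  apply: eq_mean => y; rewrite [RHS](nuR i); last first.
    exact: (bounded_mfun_comp (pair2_measurable y) (bGS S)).
  apply: eq_mean => x; apply: eq_mean => z.
  by rewrite /K /= mix_resample// (gi _ _ (agree_off_mix x z)).
rewrite -(mean_swap nu nu (bGS S)).
by apply: eq_mean => x; rewrite /partial_mean -meanZ//; exact: bounded_mfun_mix.
Qed.

End partial_mean.

(** * Averages over a random set of coordinates *)

Section random_subset.
Context {R : realType} {n : nat}.
Implicit Types (S : {set 'I_n}) (F : {set 'I_n} -> R) (r : R).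

Definition subset_weight r S : R := r ^+ #|S| * (1 - r) ^+ #|~: S|.

(** The weight of [S] with the factor of the coordinate [i], assumed to be in
    [S], taken out. *)
Definition subset_coweight r i S : R := r ^+ #|S :\ i| * (1 - r) ^+ #|~: S|.

Lemma sum_subsets_pair i F :
  \sum_S F S = \sum_(S : {set 'I_n} | i \in S) (F S + F (S :\ i)%SET).
Proof.
rewrite (bigID (fun S => i \in S)) big_split /=; congr (_ + _).
rewrite (reindex_onto (fun S => (S :\ i)%SET) (fun S => (i |: S)%SET)) /=.
  apply: eq_bigl => S; rewrite finset.in_setD1 eqxx /=.
  apply/eqP/idP => [<-|]; first by rewrite setU11.
  exact: finset.setD1K.
by move=> S iS; rewrite finset.setU1K.
Qed.

Lemma subset_weight_in r i S : i \in S ->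
  subset_weight r S = r * subset_coweight r i S.
Proof.
by move=> iS; rewrite /subset_weight /subset_coweight (cardsD1 i S) iS exprS mulrA.
Qed.

Lemma subset_weight_D1 r i S : i \in S ->
  subset_weight r (S :\ i)%SET = (1 - r) * subset_coweight r i S.
Proof.
move=> iS; rewrite /subset_weight /subset_coweight.
have -> : (~: (S :\ i) = i |: ~: S)%SET.
  apply/setP => j; rewrite !inE negb_and negbK.
  by have [->|] := eqVneq j i.
by rewrite cardsU1 !inE iS /= exprS mulrCA.
Qed.

Lemma subset_weight_ge0 r S : 0 <= r <= 1 -> 0 <= subset_weight r S.
Proof. by move=> /andP[r0 r1]; rewrite mulr_ge0// exprn_ge0// subr_ge0. Qed.

Lemma subset_coweight_ge0 r i S : 0 <= r <= 1 -> 0 <= subset_coweight r i S.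
Proof. by move=> /andP[r0 r1]; rewrite mulr_ge0// exprn_ge0// subr_ge0. Qed.

Lemma sum_subset_weight i r F : \sum_S subset_weight r S * F S =
  \sum_(S : {set 'I_n} | i \in S)
    subset_coweight r i S * (r * F S + (1 - r) * F (S :\ i)%SET).
Proof.
rewrite (sum_subsets_pair i); apply: eq_bigr => S iS.
by rewrite (subset_weight_in r iS) (subset_weight_D1 r iS); ring.
Qed.

Lemma sum_subset_weight0 F : \sum_S subset_weight 0 S * F S = F finset.set0.
Proof.
rewrite (bigD1 finset.set0) //= big1 ?addr0.
  by rewrite /subset_weight finset.cards0 expr0 subr0 expr1n !mul1r.
move=> S S0; rewrite /subset_weight expr0n cards_eq0 (negbTE S0) /=.
by rewrite !mul0r.
Qed.

Lemma sum_subset_weight1 F : \sum_S subset_weight 1 S * F S = F [set: 'I_n]%SET.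
Proof.
rewrite (bigD1 [set: 'I_n]%SET) //= big1 ?addr0.
  by rewrite /subset_weight expr1n subrr finset.setCT finset.cards0 expr0 !mul1r.
move=> S S1; rewrite /subset_weight subrr expr0n cards_eq0.
have -> : (~: S == finset.set0)%SET = false.
  by apply/negbTE; apply: contra S1 => /eqP; rewrite -finset.setCT => /finset.setC_inj ->.
by rewrite mulr0 mul0r.
Qed.

Let is_derive_subset_weight r S : is_derive r 1 (subset_weight^~ S)
  (\sum_i if i \in S then subset_coweight r i S
          else - subset_coweight r i (i |: S)%SET).
Proof.
have d1 := is_derive_powf #|S| (is_derive_idf r).
have d2 := is_derive_powf #|~: S| (is_derive_subf (is_derive_cstf 1 r) (is_derive_idf r)).
apply: is_derive_eq (is_derive_mulf d1 d2) _.
rewrite [RHS](bigID (fun i => i \in S)) /=.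
rewrite (eq_bigr (fun=> r ^+ #|S|.-1 * (1 - r) ^+ #|~: S|)); last first.
  by move=> i iS; rewrite iS /subset_coweight (cardsD1 i S) iS.
rewrite [X in _ = _ + X](eq_bigr (fun=> - (r ^+ #|S| * (1 - r) ^+ #|~: S|.-1))); last first.
  move=> i iS; rewrite (negbTE iS) /subset_coweight finset.setU1K//.
  have -> : (~: S = i |: ~: (i |: S))%SET.
    apply/setP => j; rewrite !inE negb_or.
    by have [->|] := eqVneq j i.
  by rewrite cardsU1 !inE eqxx.
rewrite !sumr_const.
have -> : #|[pred i | i \notin S]| = #|~: S| by apply: eq_card => j; rewrite !inE.
move: #|S| #|~: S| => k m; rewrite mulNrn sub0r mulrN1 mulr1 mulrN.
by rewrite -[X in _ = X - _]mulr_natl -[X in _ = _ - X]mulr_natl !mulrA [X in _ = _ - X * _]mulrC.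
Qed.

(** Russo's formula, [subset_weight r] being the law of a random set to which
    each index belongs independently with probability [r]. *)
Lemma is_derive_sum_subset_weight r F :
  is_derive r 1 (fun x => \sum_S subset_weight x S * F S)
  (\sum_i \sum_(S : {set 'I_n} | i \in S)
    subset_coweight r i S * (F S - F (S :\ i)%SET)).
Proof.
apply: (is_derive_eq (is_derive_sumf
  (fun S => is_derive_mulf (is_derive_subset_weight r S) (is_derive_cstf (F S) r)))).
under eq_bigr do rewrite mulr0 addr0 mulr_suml.
rewrite exchange_big /=; apply: eq_bigr => i _.
rewrite (sum_subsets_pair i); apply: eq_bigr => S iS.
rewrite iS finset.in_setD1 eqxx /= finset.setD1K//.
by rewrite mulrBr mulNr.
Qed.

End random_subset.

(** * Self-bounding functions with unit increments *)

(** The functions [fi i] stand for the coordinatewise infima. They are kept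
    abstract, so that [f] and its infima can be rescaled together. *)
Definition unit_self_bounding (R : realType) d (X : measurableType d) n
    (a b : R) (f : n.-tuple X -> R) (fi : 'I_n -> n.-tuple X -> R) : Prop :=
  [/\ bounded_mfun f, forall i, bounded_mfun (fi i),
      forall i, insensitive i (fi i),
      forall i x, 0 <= f x - fi i x <= 1 &
      forall x, \sum_i (f x - fi i x) <= a * f x + b].

Section unit_self_bounding.
Context {R : realType} {d : measure_display} {X : measurableType d} {n : nat}.
Variables (nu : probability (n.-tuple X) R) (a b : R).
Variables (f : n.-tuple X -> R) (fi : 'I_n -> n.-tuple X -> R).
Hypothesis nuR : resampling_invariant nu.
Hypothesis sb : unit_self_bounding a b f fi.

Local Notation E F := (\int[nu]_x F x).
Local Notation mu := (\int[nu]_x f x).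
Local Notation W := (fun x => a * f x + b).

Let bf : bounded_mfun f. Proof. by have [] := sb. Qed.
Let bfi i : bounded_mfun (fi i). Proof. by have [] := sb. Qed.
Let fi_insensitive i : insensitive i (fi i). Proof. by have [] := sb. Qed.
Let Di i x := f x - fi i x.
Let Di01 i x : 0 <= Di i x <= 1. Proof. by have [_ _ _ + _] := sb; apply. Qed.
Let sumDi x : \sum_i Di i x <= W x. Proof. by have [_ _ _ _] := sb; apply. Qed.
Let bDi i : bounded_mfun (Di i). Proof. exact: bounded_mfunB. Qed.
Let bW : bounded_mfun W.
Proof. by apply: bounded_mfunD; [exact: bounded_mfunZ|exact: bounded_mfun_cst]. Qed.

Lemma mean_affine : \int[nu]_x (a * f x + b) = a * mu + b.
Proof.
rewrite meanD; [|exact: bounded_mfunZ|exact: bounded_mfun_cst].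
by rewrite meanZ// mean_cst.
Qed.

Lemma agree_off_le1 i x y : agree_off i x y -> f x - f y <= 1.
Proof.
move=> xy; have /andP[_ h1] := Di01 i x; have /andP[h2 _] := Di01 i y.
by move: h1 h2; rewrite /Di (fi_insensitive xy) => h1 h2; lra.
Qed.

Section lower.
Variable lam : R.
Hypothesis lam0 : 0 <= lam.
Hypothesis a0 : 0 <= a.

Let h x := expR (- lam * f x).
Let bh : bounded_mfun h.
Proof. by apply/bounded_mfun_expR/bounded_mfunZ. Qed.
Let hS S := partial_mean nu S h.
Let bhS S : bounded_mfun (hS S). Proof. exact: bounded_mfun_partial_mean. Qed.
Let hS_ge0 S x : 0 <= hS S x.
Proof. by apply: partial_mean_ge => // y; exact: expR_ge0. Qed.
Let e S := \int[nu]_x (hS S x * W x).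
Let eD i S := \int[nu]_x (hS S x * Di i x).

Let hS_D1 (S : {set 'I_n}) i x : hS (S :\ i)%SET x <= expR lam * hS S x.
Proof.
rewrite /hS /partial_mean -meanZ; last exact: bounded_mfun_mix.
apply: le_mean; [exact: bounded_mfun_mix| |move=> y].
  by apply: bounded_mfunZ; exact: bounded_mfun_mix.
rewrite -expRD ler_expR.
have h1 : f (mix S x y) - f (mix (S :\ i)%SET x y) <= 1.
  apply: (@agree_off_le1 i) => j ji.
  by rewrite (agree_off_mixD1 S x y ji).
have := ler_wpM2l lam0 h1; rewrite mulr1 mulrBr => h2.
by rewrite !mulNr; lra.
Qed.

Let eD_ge0 i S : 0 <= eD i S.
Proof.
apply: Rintegral_ge0 => x _; apply: mulr_ge0 => //.
by have /andP[] := Di01 i x.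
Qed.

Let eD_D1 i (S : {set 'I_n}) : eD i (S :\ i)%SET <= expR lam * eD i S.
Proof.
rewrite /eD -meanZ; last exact: bounded_mfunM.
apply: le_mean; [exact: bounded_mfunM|by apply: bounded_mfunZ; exact: bounded_mfunM|].
move=> x; rewrite mulrA; apply: ler_wpM2r; last exact: hS_D1.
by have /andP[] := Di01 i x.
Qed.

(** Inserting coordinate [i] changes the mean of [a * f + b] by the same amount
    as that of [a * Di i], because their difference [a * fi i + b] does not
    depend on coordinate [i]. *)
Let e_D1 i (S : {set 'I_n}) : i \in S ->
  e S - e (S :\ i)%SET = a * (eD i S - eD i (S :\ i)%SET).
Proof.
move=> iS; pose g x := a * fi i x + b.
have bg : bounded_mfun g.
  by apply: bounded_mfunD; [exact: bounded_mfunZ|exact: bounded_mfun_cst].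
have gi : insensitive i g by move=> x y xy; rewrite /g (fi_insensitive xy).
have split_e U : e U = \int[nu]_x (g x * hS U x) + a * eD i U.
  rewrite /e /eD -meanZ; last exact: bounded_mfunM.
  rewrite -meanD; [|exact: bounded_mfunM|].
    by apply: eq_mean => x; rewrite /g /Di; ring.
  by apply: bounded_mfunZ; exact: bounded_mfunM.
rewrite (split_e S) (split_e (S :\ i)%SET) (mean_partial_meanD1 nuR iS gi bg bh).
by rewrite opprD addrACA subrr add0r mulrBr.
Qed.

(** Up to the factor [\int[nu]_x h x], [w r] is the mean of [a * f + b]
    at a sample of the law with density proportional to [h] of which each
    coordinate is kept with probability [r] and redrawn otherwise. In [dw_ge],
    [hS_D1] bounds the effect of one coordinate by a multiple of the mean of
    [Di i] along the interpolation itself. As that mean is an average over kept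
    and redrawn coordinates alike, the sum over [i] is again controlled by
    [w r], and the factor [a * (expR lam - 1) / q r] is the derivative of
    [- a * ln (q r)]. *)
Let q r := r + (1 - r) * expR lam.
Let w r := \sum_S subset_weight r S * e S.

Let q_gt0 (r : R) : 0 <= r <= 1 -> 0 < q r.
Proof.
move=> /andP[r0 r1]; have h1 : 1 <= expR lam by rewrite -expR0 ler_expR.
have : (1 - r) * 1 <= (1 - r) * expR lam by apply: ler_wpM2l => //; lra.
by rewrite /q; lra.
Qed.

Let dw r := \sum_i \sum_(S : {set 'I_n} | i \in S)
    subset_coweight r i S * (e S - e (S :\ i)%SET).

Let dw_ge (r : R) : 0 <= r <= 1 -> 0 <= dw r + a * ((expR lam - 1) / q r) * w r.
Proof.
move=> r01; have q0 := q_gt0 r01.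
have h1 : 1 <= expR lam by rewrite -expR0 ler_expR.
set c := (expR lam - 1) / q r.
have c0 : 0 <= c by rewrite divr_ge0 ?subr_ge0// ltW.
have key i (S : {set 'I_n}) : i \in S -> eD i (S :\ i)%SET - eD i S <=
    c * (r * eD i S + (1 - r) * eD i (S :\ i)%SET).
  move=> iS; rewrite -(ler_pM2r q0) /c mulrAC -[X in _ <= X * _]mulrA.
  rewrite mulVf ?gt_eqF// mulr1.
  have alg (x y L : R) : y <= L * x ->
      (y - x) * (r + (1 - r) * L) <= (L - 1) * (r * x + (1 - r) * y).
    by move=> yx; rewrite -subr_ge0 (_ : _ - _ = L * x - y) ?subr_ge0//; ring.
  exact: alg.
have le_w : \sum_i \sum_S subset_weight r S * eD i S <= w r.
  rewrite exchange_big /=; apply: ler_sum => S _; rewrite -mulr_sumr.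
  apply: ler_wpM2l; first exact: subset_weight_ge0.
  rewrite /eD -mean_sum; last by move=> i; exact: bounded_mfunM.
  apply: le_mean; [|exact: bounded_mfunM|move=> x].
    by apply: bounded_mfun_sum => i; exact: bounded_mfunM.
  by rewrite -mulr_sumr; apply: ler_wpM2l.
suff : - dw r <= a * c * \sum_i \sum_S subset_weight r S * eD i S.
  move=> h2; have : a * c * \sum_i \sum_S subset_weight r S * eD i S <= a * c * w r.
    by apply: ler_wpM2l => //; exact: mulr_ge0.
  lra.
rewrite mulr_sumr -sumrN; apply: ler_sum => i _.
rewrite (sum_subset_weight i) mulr_sumr -sumrN; apply: ler_sum => S iS.
rewrite e_D1// -mulrN [leRHS]mulrCA; apply: ler_wpM2l.
  exact: subset_coweight_ge0.
rewrite -mulrN -mulrA; apply: ler_wpM2l => //; rewrite opprB; exact: key.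
Qed.

(** The interpolation at [r = 0] and [r = 1]: tilting the law by [h] divides
    the mean of [a * f + b] by at most [expR (a * lam)]. *)
Lemma laplace_lower_affine :
  (a * mu + b) * \int[nu]_x h x <=
  expR (a * lam) * \int[nu]_x (h x * (a * f x + b)).
Proof.
pose u r := w r * expR (- a * ln (q r)).
pose du r := dw r * expR (- a * ln (q r)) + w r *
   (expR (- a * ln (q r)) * (- a * ((q r)^-1 * (1 + - expR lam)))).
have hu (r : R) : 0 <= r <= 1 -> is_derive r 1 u (du r).
  move=> r01; apply: is_derive_mulf (is_derive_sum_subset_weight r e) _.
  apply: is_derive_expRf; apply: is_derive_scalef; apply: is_derive_lnf.
    exact: q_gt0.
  have dc := is_derive_subf (is_derive_cstf 1 r) (is_derive_idf r).
  have dL := is_derive_mulf dc (is_derive_cstf (expR lam) r).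
  apply: is_derive_eq (is_derive_addf (is_derive_idf r) dL) _.
  by rewrite mulr0 addr0 sub0r mulN1r.
have hdu (r : R) : 0 <= r <= 1 -> 0 <= du r.
  move=> r01; rewrite (_ : du r = expR (- a * ln (q r)) *
      (dw r + a * ((expR lam - 1) / q r) * w r)); last first.
    have alg (x y z t L A : R) : x * y + z * (y * (- A * (t * (1 + - L)))) =
      y * (x + A * ((L - 1) * t) * z) by ring.
    exact: alg.
  by apply: mulr_ge0; [exact: expR_ge0|exact: dw_ge].
have q0 : q 0 = expR lam by rewrite /q subr0 add0r mul1r.
have q1 : q 1 = 1 by rewrite /q subrr mul0r addr0.
have e0 : e finset.set0 = (\int[nu]_x h x) * (a * mu + b).
  rewrite /e /hS; under eq_mean do rewrite partial_mean_set0.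
  by rewrite meanZ// mean_affine.
have eT : e [set: 'I_n]%SET = \int[nu]_x (h x * (a * f x + b)).
  by rewrite /e /hS partial_mean_setT.
have w0 : w 0 = (\int[nu]_x h x) * (a * mu + b).
  by rewrite -e0; exact: sum_subset_weight0.
have w1 : w 1 = \int[nu]_x (h x * (a * f x + b)).
  by rewrite -eT; exact: sum_subset_weight1.
have := is_derive_ge0_le ler01 hu hdu.
rewrite /u q0 q1 w0 w1 ln1 mulr0 expR0 mulr1 expRK.
move: (\int[nu]_x h x) (\int[nu]_x (h x * _)) => N NW h1.
have := ler_wpM2l (expR_ge0 (a * lam)) h1.
by rewrite mulrCA -expRD mulNr subrr expR0 mulr1 mulrC.
Qed.

End lower.
End unit_self_bounding.

(** * Laplace transforms of bounded functions *)

Section laplace.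
Context {R : realType} {d : measure_display} {T : measurableType d}.
Variables (P : probability T R) (f : T -> R).
Hypothesis bf : bounded_mfun f.
Implicit Types lam : R.

Definition laplace lam : R := \int[P]_x expR (lam * f x).

Definition dlaplace lam : R := \int[P]_x (f x * expR (lam * f x)).

Lemma bounded_mfun_expRZ lam : bounded_mfun (fun x => expR (lam * f x)).
Proof. by apply/bounded_mfun_expR/bounded_mfunZ. Qed.

Lemma laplace_gt0 lam : 0 < laplace lam.
Proof.
have [_ [B fB]] := bf.
apply: (@lt_le_trans _ _ (expR (- (`|lam| * B)))); first exact: expR_gt0.
rewrite -[leLHS](mean_cst P); apply: le_mean => [||x].
- exact: bounded_mfun_cst.
- exact: bounded_mfun_expRZ.
rewrite ler_expR lerNl -mulNr (le_trans (ler_norm _))// normrM normrN.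
by apply: ler_wpM2l.
Qed.

Lemma laplace0 : laplace 0 = 1.
Proof.
by rewrite /laplace; under eq_mean do rewrite mul0r expR0; exact: mean_cst.
Qed.

Lemma dlaplace0 : dlaplace 0 = \int[P]_x f x.
Proof. by apply: eq_mean => x; rewrite mul0r expR0 mulr1. Qed.

Lemma is_derive_laplace lam : is_derive lam 1 laplace (dlaplace lam).
Proof.
have [mf [B fB]] := bf.
pose g (l : R) x := expR (l * f x).
have dg (l : R) x : is_derive l 1 (g ^~ x) (f x * expR (l * f x)).
  apply: is_derive_eq (is_derive_expRf (is_derive_mulf (is_derive_idf l)
    (is_derive_cstf (f x) l))) _.
  by rewrite mul1r mulr0 addr0 mulrC.
have dgE (l : R) x : partial1of2 g l x = f x * expR (l * f x).
  by rewrite partial1of2E; have := dg l x => h; rewrite derive_val.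
have lamI : lam \in `]lam - 1, lam + 1[ by rewrite in_itv /=; lra.
have intg (l : R) : `]lam - 1, lam + 1[%classic l -> P.-integrable [set: T] (EFin \o g l).
  by move=> _; apply: bounded_mfun_integrable; exact: bounded_mfun_expRZ.
have derg (l : R) x : `]lam - 1, lam + 1[%classic l -> [set: T] x -> derivable (g ^~ x) l 1.
  by move=> _ _; have := dg l x => h; exact: ex_derive.
pose C := B * expR ((`|lam| + 1) * B).
have C0 (x : T) : 0 <= (fun=> C) x :> R.
  have B0 : 0 <= B by exact: le_trans (normr_ge0 _) (fB x).
  by rewrite mulr_ge0// expR_ge0.
have intC : P.-integrable [set: T] (EFin \o (fun=> C)).
  by apply: bounded_mfun_integrable; exact: bounded_mfun_cst.
have ubg (l : R) x : `]lam - 1, lam + 1[%classic l -> [set: T] x ->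
    `|partial1of2 g l x| <= (fun=> C) x.
  rewrite /= in_itv /= => /andP[l1 l2] _; rewrite dgE normrM.
  apply: ler_pM => //; rewrite ger0_norm ?expR_ge0// ler_expR.
  rewrite (le_trans (ler_norm _))// normrM; apply: ler_pM => //.
  rewrite ler_norml.
  have := ler_norm lam; have := ler_norm (- lam); rewrite normrN => h1 h2.
  by clear - l1 l2 h1 h2; apply/andP; split; lra.
apply: DeriveDef.
  exact: (derivable_under_integral measurableT lamI intg derg C0 intC ubg).
rewrite -derive1E.
rewrite (differentiation_under_integral measurableT lamI intg derg C0 intC ubg).
by apply: eq_mean => x; rewrite dgE.
Qed.

Lemma mean_expRZ_affine lam a b :
  \int[P]_x (expR (lam * f x) * (a * f x + b)) =
  a * dlaplace lam + b * laplace lam.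
Proof.
have bh := bounded_mfun_expRZ lam.
rewrite -!meanZ//; last exact: bounded_mfunM.
rewrite -meanD; [|by apply: bounded_mfunZ; exact: bounded_mfunM|exact: bounded_mfunZ].
have alg (y z A B : R) : y * (A * z + B) = A * (z * y) + B * y by ring.
by apply: eq_mean => x; exact: alg.
Qed.

(** Chernoff's bound; a negative [lam] gives lower tails. *)
Lemma chernoff_laplace lam c :
  (P [set x | (c <= lam * f x)%R] <= (expR (- c) * laplace lam)%:E)%E.
Proof.
have mA : measurable [set x | c <= lam * f x].
  have [mlf _] := bounded_mfunZ lam bf.
  rewrite (_ : [set x | _] = (fun x => lam * f x) @^-1` `[c, +oo[).
    by rewrite -[X in measurable X]setTI; exact: mlf.
  by apply/seteqP; split => x /=; rewrite in_itv /= andbT.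
have be := bounded_mfunZ (expR (- c)) (bounded_mfun_expRZ lam).
rewrite -meanZ; last exact: bounded_mfun_expRZ.
rewrite fineK; last first.
  apply: integrable_fin_num => //; exact: (bounded_mfun_integrable P be).
rewrite -[X in P X]setIT -integral_indic//; apply: ge0_le_integral => //.
- by apply/measurable_EFinP; exact: measurable_indic.
- by apply/measurable_EFinP; have [] := be.
move=> x _; rewrite lee_fin indicE -expRD.
have [/set_mem /= cx|_] := boolP (x \in [set x | c <= lam * f x]).
  by rewrite -expR0 ler_expR addrC subr_ge0.
exact: expR_ge0.
Qed.

End laplace.

(** * The lower tail *)

Section lower_tail.
Context {R : realType} {d : measure_display} {X : measurableType d} {n : nat}.
Variables (nu : probability (n.-tuple X) R) (a b : R).
Variables (f : n.-tuple X -> R) (fi : 'I_n -> n.-tuple X -> R).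
Hypothesis nuR : resampling_invariant nu.
Hypothesis sb : unit_self_bounding a b f fi.

Local Notation mu := (\int[nu]_x f x).

Let bf : bounded_mfun f. Proof. by have [] := sb. Qed.

(** Since [1 - a * lam <= expR (- (a * lam))], tilting by [expR (- lam * f)]
    lowers the mean of [f] by at most [lam * (a * mu + b)]. *)
Lemma laplace_lower_slope_pos lam : 0 <= lam -> 0 < a -> 0 <= a * mu + b ->
  mu * laplace nu f (- lam) - dlaplace nu f (- lam) <=
  lam * (a * mu + b) * laplace nu f (- lam).
Proof.
move=> lam0 a0 v0; have := laplace_lower_affine nuR sb lam0 (ltW a0).
rewrite (mean_expRZ_affine nu bf) -/(laplace nu f (- lam)).
have := laplace_gt0 nu bf (- lam).
move: (laplace nu f (- lam)) (dlaplace nu f (- lam)) mu v0 => N N' m v0 N0 h1.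
have h2 : 1 - a * lam <= expR (- (a * lam)) := expR_ge1Dx (- (a * lam)).
have h3 : expR (- (a * lam)) * ((a * m + b) * N) <= a * N' + b * N.
  have := ler_wpM2l (expR_ge0 (- (a * lam))) h1.
  by rewrite [leRHS]mulrA -expRD addNr expR0 mul1r.
have h4 : (1 - a * lam) * ((a * m + b) * N) <= a * N' + b * N.
  apply: le_trans h3; apply: ler_wpM2r => //; exact: mulr_ge0 v0 (ltW N0).
rewrite -(ler_pM2l a0); clear - h4.
have -> : a * (lam * (a * m + b) * N) = (a * m + b) * N -
  (1 - a * lam) * ((a * m + b) * N) by ring.
have -> : a * (m * N - N') = (a * m + b) * N - (a * N' + b * N) by ring.
by rewrite lerD2l lerN2.
Qed.

End lower_tail.

Section lower_tail_bound.
Context {R : realType} {d : measure_display} {X : measurableType d} {n : nat}.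
Variables (nu : probability (n.-tuple X) R) (a b : R).
Variables (f : n.-tuple X -> R) (fi : 'I_n -> n.-tuple X -> R).
Hypothesis nuR : resampling_invariant nu.
Hypothesis sb : unit_self_bounding a b f fi.
Hypotheses (f_ge0 : forall x, 0 <= f x) (a_ge0 : 0 <= a) (b_ge0 : 0 <= b).

Local Notation mu := (\int[nu]_x f x).

Let bf : bounded_mfun f. Proof. by have [] := sb. Qed.
Let mu_ge0 : 0 <= mu. Proof. exact: Rintegral_ge0. Qed.

(** Since [f] is nonnegative, [a] may be enlarged; letting the increase tend
    to zero removes the restriction to positive [a]. *)
Lemma laplace_lower_slope lam : 0 <= lam ->
  mu * laplace nu f (- lam) - dlaplace nu f (- lam) <=
  lam * (a * mu + b) * laplace nu f (- lam).
Proof.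
move=> lam0; have N0 := laplace_gt0 nu bf (- lam).
have slope eps : 0 < eps ->
    mu * laplace nu f (- lam) - dlaplace nu f (- lam) <=
    lam * ((a + eps) * mu + b) * laplace nu f (- lam).
  move=> eps0; have a'0 : 0 < a + eps by rewrite ltr_wpDl.
  have sb' : unit_self_bounding (a + eps) b f fi.
    have [s1 s2 s3 s4 s5] := sb; split => // x; apply: le_trans (s5 x) _.
    by rewrite lerD2r ler_wpM2r// lerDl ltW.
  apply: (laplace_lower_slope_pos nuR sb') => //.
  by rewrite addr_ge0// mulr_ge0// ltW.
move: (laplace nu f (- lam)) (dlaplace nu f (- lam)) mu mu_ge0 N0 slope.
move=> N N' m m0 N0 slope; apply/ler_addgt0Pr => e e0.
pose K := lam * m * N + 1.
have K0 : 0 < K by rewrite /K ltr_wpDl// !mulr_ge0// ltW.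
have := slope (e / K) (divr_gt0 e0 K0); move/le_trans; apply.
have -> : lam * ((a + e / K) * m + b) * N =
  lam * (a * m + b) * N + (e / K) * (lam * m * N) by ring.
rewrite lerD2l -[leRHS](divfK (negbT (gt_eqF K0))) ler_wpM2l//.
  by rewrite divr_ge0// ltW.
by rewrite /K lerDl.
Qed.

(** Integrating the slope bound: the logarithm of the Laplace transform at
    [- lam] has derivative minus the tilted mean. *)
Lemma laplace_lower lam : 0 <= lam ->
  laplace nu f (- lam) <= expR (- (lam * mu) + (a * mu + b) * lam ^+ 2 / 2).
Proof.
move=> lam0; pose v := a * mu + b.
pose u l := - (l * mu) + v * l ^+ 2 / 2 - ln (laplace nu f (- l)).
pose du l := - mu + v * l + (laplace nu f (- l))^-1 * dlaplace nu f (- l).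
have dN (l : R) : is_derive l 1 (fun y => laplace nu f (- y)) (dlaplace nu f (- l) * - 1).
  exact: (is_derive1_comp (is_derive_laplace nu bf (- l))
    (is_derive_oppf (is_derive_idf l))).
have alg (x m v' y z : R) : - (1 * m + x * 0) + ((0 * (x ^+ 2) + v' * (2%:R * x * 1)) * 2^-1
    + (v' * x ^+ 2) * 0) - y * (z * - 1) = - m + v' * x + y * z by field.
have hu (l : R) : 0 <= l <= lam -> is_derive l 1 u (du l).
  move=> _.
  have d1 := is_derive_oppf (is_derive_mulf (is_derive_idf l) (is_derive_cstf mu l)).
  have d2 := is_derive_mulf (is_derive_cstf v l) (is_derive_powf 2 (is_derive_idf l)).
  have d3 := is_derive_mulf d2 (is_derive_cstf 2^-1 l).
  have d4 := @is_derive_lnf _ (fun y => laplace nu f (- y)) l _ (laplace_gt0 nu bf (- l)) (dN l).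
  apply: is_derive_eq (is_derive_subf (is_derive_addf d1 d3) d4) _.
  exact: alg.
have hdu (l : R) : 0 <= l <= lam -> 0 <= du l.
  move=> /andP[l0 _]; have N0 := laplace_gt0 nu bf (- l).
  have := laplace_lower_slope l0; rewrite -/v /du.
  move: (laplace nu f (- l)) (dlaplace nu f (- l)) mu N0 => N N' m N0 h1.
  rewrite -(pmulr_rge0 _ N0) (_ : N * _ = l * v * N - (m * N - N')).
    by rewrite subr_ge0.
  by field; rewrite gt_eqF.
have := is_derive_ge0_le lam0 hu hdu.
rewrite (_ : u 0 = 0); last first.
  by rewrite /u oppr0 laplace0 ln1 expr0n /= mulr0 !mul0r oppr0 !addr0.
rewrite /u subr_ge0 => h1.
by rewrite -[leLHS]lnK ?ler_expR// posrE; exact: laplace_gt0.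
Qed.

End lower_tail_bound.

(** * Entropy of the exponential of a self-bounding function *)

(** Convexity of the exponential between [- lam] and [0]. *)
Lemma expR_chord (R : realType) (lam D : R) : 0 <= D <= 1 ->
  expR (- lam * D) <= 1 - D + D * expR (- lam).
Proof.
move=> D01; have := convex_expR (Itv01 (andP D01).1 (andP D01).2) (- lam) 0.
rewrite convRE expR0 /=.
by rewrite convRE /= /unstable.onem mulr0 addr0 mulrN mulrC -mulNr mulr1 addrC.
Qed.

Section entropy.
Context {R : realType} {d : measure_display} {X : measurableType d} {n : nat}.
Variables (nu : probability (n.-tuple X) R) (a b : R).
Variables (f : n.-tuple X -> R) (fi : 'I_n -> n.-tuple X -> R).
Hypothesis nuR : resampling_invariant nu.
Hypothesis sb : unit_self_bounding a b f fi.
Variable lam : R.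

Let bf : bounded_mfun f. Proof. by have [] := sb. Qed.
Let bfi i : bounded_mfun (fi i). Proof. by have [] := sb. Qed.
Let fi_insensitive i : insensitive i (fi i). Proof. by have [] := sb. Qed.
Let h x := expR (lam * f x).
Let u i x := expR (lam * fi i x).
Let hS (S : {set 'I_n}) := partial_mean nu S h.
Let bh : bounded_mfun h. Proof. exact: bounded_mfun_expRZ. Qed.
Let bu i : bounded_mfun (u i). Proof. exact: bounded_mfun_expRZ. Qed.
Let bhS S : bounded_mfun (hS S). Proof. exact: bounded_mfun_partial_mean. Qed.

Let hS_lower : exists2 c, 0 < c & forall S x, c <= hS S x.
Proof.
have [_ [B fB]] := bf; exists (expR (- (`|lam| * B))); first exact: expR_gt0.
move=> S; apply: partial_mean_ge => // x.
rewrite ler_expR lerNl -mulNr (le_trans (ler_norm _))// normrM normrN.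
by apply: ler_wpM2l.
Qed.

Let bln S : bounded_mfun (fun x => ln (hS S x)).
Proof. by have [c c0 ch] := hS_lower; exact: (bounded_mfun_ln c0). Qed.

Let loss i x := h x * (expR (- lam * (f x - fi i x)) - 1 + lam * (f x - fi i x)).

Let bloss i : bounded_mfun (loss i).
Proof.
have bD : bounded_mfun (fun x => f x - fi i x) by exact: bounded_mfunB.
apply: bounded_mfunM => //; apply: bounded_mfunD; last exact: bounded_mfunZ.
apply: bounded_mfunB; last exact: bounded_mfun_cst.
exact: bounded_mfun_expRZ.
Qed.

(** One coordinate of the tensorization: from [1 + z <= expR z] applied to
    [z = ln (hS S / hS (S :\ i)) + ln (u i / h)], the mean of the exponential
    term being computed by averaging over coordinate [i]. *)
Let entropy_step (S : {set 'I_n}) i : i \in S ->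
  \int[nu]_x (h x * (ln (hS S x) - ln (hS (S :\ i)%SET x))) <=
  \int[nu]_x loss i x.
Proof.
move=> iS; have [c c0 ch] := hS_lower.
have hS0 U x : 0 < hS U x by exact: lt_le_trans (ch U x).
pose g x := u i x * (hS (S :\ i)%SET x)^-1.
have bV : bounded_mfun (fun x => (hS (S :\ i)%SET x)^-1).
  exact: (bounded_mfunV c0).
have bg : bounded_mfun g by exact: bounded_mfunM.
have gi : insensitive i g.
  move=> x y xy; rewrite /g /u (fi_insensitive xy).
  by rewrite /hS (@insensitive_partial_mean _ _ _ _ nu S i h x y xy).
have swap := mean_partial_meanD1 nuR iS gi bg bh.
have b1 : bounded_mfun (fun x => g x * hS S x) by exact: bounded_mfunM.
have b2 : bounded_mfun (fun x => g x * hS S x - u i x) by exact: bounded_mfunB.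
apply: (@le_trans _ _ (\int[nu]_x (loss i x + (g x * hS S x - u i x)))).
  apply: le_mean => [||x].
  - exact: (bounded_mfunM bh (bounded_mfunB (bln S) (bln (S :\ i)%SET))).
  - exact: (bounded_mfunD (bloss i) b2).
  set A := ln (hS S x) - ln (hS (S :\ i)%SET x).
  have uE : u i x = h x * expR (- lam * (f x - fi i x)).
    by rewrite /u /h -expRD; congr expR; ring.
  have gE : g x * hS S x = u i x * expR A.
    have -> : expR A = hS S x * (hS (S :\ i)%SET x)^-1.
      by rewrite /A expRD expRN (lnK (hS0 S x)) (lnK (hS0 (S :\ i)%SET x)).
    by rewrite [RHS]mulrCA mulrC.
  have alg (y e1 e2 A' l D : R) : 0 <= y -> 1 + (A' + - l * D) <= e2 * e1 ->
      y * A' <= y * (e1 - 1 + l * D) + (y * e1 * e2 - y * e1).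
    move=> y0 /(ler_wpM2l y0); rewrite -subr_ge0 => h1; rewrite -subr_ge0.
    by apply: le_trans h1 _; rewrite le_eqVlt; apply/orP; left; apply/eqP; ring.
  rewrite gE uE; apply: alg; first exact: expR_ge0.
  by rewrite -expRD; exact: expR_ge1Dx.
have gu : \int[nu]_x (g x * partial_mean nu (S :\ i)%SET h x) = \int[nu]_x u i x.
  by apply: eq_mean => x; exact: (divfK (lt0r_neq0 (hS0 (S :\ i)%SET x)) (u i x)).
rewrite (meanD nu (bloss i) b2) (meanB nu b1 (bu i)) -swap gu.
by rewrite subrr addr0.
Qed.

(** The entropy of [h] is the mean of [h] times the telescoping sum of the
    increments of [ln (hS S)], coordinates being revealed one after the other;
    [entropy_step] bounds each of them. *)
Lemma entropy_tensorization :
  lam * dlaplace nu f lam - laplace nu f lam * ln (laplace nu f lam) <=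
  \sum_i \int[nu]_x (expR (lam * f x) *
    (expR (- lam * (f x - fi i x)) - 1 + lam * (f x - fi i x))).
Proof.
pose S k := [set j : 'I_n | (j < k)%N]%SET.
have S0 : S 0%N = finset.set0 by apply/setP => j; rewrite !inE.
have Sn : S n = [set: 'I_n]%SET by apply/setP => j; rewrite !inE ltn_ord.
have SD (i : 'I_n) : (S i.+1 :\ i)%SET = S i.
  by apply/setP => j; rewrite !inE ltnS ltn_neqAle.
have lnh x : ln (hS (S n) x) = lam * f x.
  by rewrite Sn /hS partial_mean_setT /h expRK.
have lnN x : ln (hS (S 0%N) x) = ln (laplace nu f lam).
  by rewrite S0 /hS partial_mean_set0.
pose step (i : 'I_n) x := h x * (ln (hS (S i.+1) x) - ln (hS (S i) x)).
have bstep i : bounded_mfun (step i).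
  exact: (bounded_mfunM bh (bounded_mfunB (bln _) (bln _))).
have -> : lam * dlaplace nu f lam - laplace nu f lam * ln (laplace nu f lam) =
    \int[nu]_x (\sum_i step i x).
  rewrite (@eq_mean _ _ _ _ _ (fun x =>
      lam * (f x * expR (lam * f x)) - ln (laplace nu f lam) * expR (lam * f x))).
    have b1 : bounded_mfun (fun x => f x * expR (lam * f x)) by exact: bounded_mfunM.
    rewrite meanB; [|exact: bounded_mfunZ|exact: bounded_mfunZ].
    by rewrite !meanZ// [X in _ = _ - X]mulrC.
  move=> x; rewrite -mulr_sumr.
  have := telescope_sumr (fun k => ln (hS (S k) x)) (leq0n n).
  rewrite big_mkord => ->; rewrite lnh lnN /h; clear.
  by rewrite mulrBr mulrCA (mulrC (expR _)) [X in _ - X]mulrC mulrA.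
rewrite mean_sum//; apply: ler_sum => i _.
have iS : i \in S i.+1 by rewrite inE.
by have := entropy_step iS; rewrite SD.
Qed.

(** By convexity the loss in coordinate [i] is at most proportional to
    [f x - fi i x], and these differences sum to at most [a * f x + b]. This is
    a differential inequality for the logarithm of the Laplace transform. *)
Lemma entropy_self_bounding :
  lam * dlaplace nu f lam - laplace nu f lam * ln (laplace nu f lam) <=
  (expR (- lam) - 1 + lam) *
  (a * dlaplace nu f lam + b * laplace nu f lam).
Proof.
have psi0 : 0 <= expR (- lam) - 1 + lam.
  by have := expR_ge1Dx (- lam); lra.
have [_ _ _ D01 sumD] := sb.
apply: (le_trans entropy_tensorization).
rewrite -mean_sum; last exact: bloss.
rewrite -(mean_expRZ_affine nu bf) -meanZ; last first.
  apply: bounded_mfunM => //; apply: bounded_mfunD; last exact: bounded_mfun_cst.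
  exact: bounded_mfunZ.
apply: le_mean => [||x].
- by apply: bounded_mfun_sum; exact: bloss.
- apply/bounded_mfunZ/bounded_mfunM => //.
  by apply: bounded_mfunD; [exact: bounded_mfunZ|exact: bounded_mfun_cst].
rewrite -mulr_sumr mulrCA; apply: ler_wpM2l; first exact: expR_ge0.
apply: le_trans (ler_wpM2l psi0 (sumD x)); rewrite mulr_sumr.
apply: ler_sum => i _; have := expR_chord lam (D01 i x).
move: (f x - fi i x) => D.
have alg (e D' l : R) : (e - 1 + l) * D' = (1 - D' + D' * e) - 1 + l * D' by ring.
by move=> h1; rewrite alg lerD2r lerD2r.
Qed.

End entropy.

(** * A differential inequality *)

Section calculus.
Context {R : realType}.
Implicit Types x a c : R.

(** Both sides vanish to second order at [0], and the second derivative of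
    their difference is nonnegative by [1 + x <= expR x]. *)
Lemma expR_sub_affine_le x : 0 <= x ->
  (expR (- x) - 1 + x) * (2 + 2 / 3 * x) <= x ^+ 2.
Proof.
move=> x0.
pose p2 (y : R) := 2 / 3 - 2 / 3 * (expR (- y) * (1 + y)).
pose p1 (y : R) := 2 / 3 * y - 4 / 3 + expR (- y) * (4 / 3 + 2 / 3 * y).
pose p (y : R) := y ^+ 2 - (expR (- y) - 1 + y) * (2 + 2 / 3 * y).
have dexp (y : R) := is_derive_expRf (is_derive_oppf (is_derive_idf y)).
have daff (A B y : R) := is_derive_addf (is_derive_cstf A y)
  (is_derive_scalef B (is_derive_idf y)).
have alg1 (y e : R) : 2 / 3 * 1 - 0 + (e * - 1 * (4 / 3 + 2 / 3 * y) +
    e * (0 + 2 / 3 * 1)) = 2 / 3 - 2 / 3 * (e * (1 + y)) by field.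
have alg2 (y e : R) : 2%:R * y * 1 - ((e * - 1 - 0 + 1) * (2 + 2 / 3 * y) +
    (e - 1 + y) * (0 + 2 / 3 * 1)) = 2 / 3 * y - 4 / 3 + e * (4 / 3 + 2 / 3 * y).
  by field.
have dp1 (y : R) : is_derive y 1 p1 (p2 y).
  have d1 := is_derive_subf (is_derive_scalef (2 / 3) (is_derive_idf y))
    (is_derive_cstf (4 / 3) y).
  have d2 := is_derive_mulf (dexp y) (daff (4 / 3) (2 / 3) y).
  by apply: is_derive_eq (is_derive_addf d1 d2) _; exact: alg1.
have dp (y : R) : is_derive y 1 p (p1 y).
  have d1 := is_derive_addf (is_derive_subf (dexp y) (is_derive_cstf 1 y))
    (is_derive_idf y).
  have d2 := is_derive_mulf d1 (daff 2 (2 / 3) y).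
  apply: is_derive_eq (is_derive_subf (is_derive_powf 2 (is_derive_idf y)) d2) _.
  exact: alg2.
have p2_ge0 (y : R) : 0 <= p2 y.
  have h1 : expR (- y) * (1 + y) <= expR (- y) * expR y.
    by rewrite ler_wpM2l ?expR_ge0// expR_ge1Dx.
  by move: h1; rewrite -expRD addNr expR0 /p2 => h1; lra.
have p1_ge0 (y : R) : 0 <= y -> 0 <= p1 y.
  move=> y0; apply: le_trans (is_derive_ge0_le y0 (fun z _ => dp1 z) (fun z _ => p2_ge0 z)).
  by rewrite /p1 oppr0 expR0; lra.
have : p 0 <= p x.
  apply: (is_derive_ge0_le x0 (fun z _ => dp z)) => z /andP[z0 _]; exact: p1_ge0.
rewrite {1}/p oppr0 expR0 expr0n /= => h1; rewrite -subr_ge0 -/(p x).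
by apply: le_trans h1; lra.
Qed.

Lemma expR_sub_affine_le_sqr x : 0 <= x -> expR (- x) - 1 + x <= x ^+ 2 / 2.
Proof.
move=> x0; have psi0 : 0 <= expR (- x) - 1 + x.
  by have := expR_ge1Dx (- x); lra.
have h1 := expR_sub_affine_le x0.
have h2 : 0 <= (expR (- x) - 1 + x) * (2 / 3 * x).
  by rewrite mulr_ge0// mulr_ge0//; lra.
by move: h1 h2; rewrite mulrDr; lra.
Qed.

(** This says that [x ^+ 2 / (2 * (1 - c * x))] is a supersolution of
    [(x - a * psi x) * G' - G = psi x], where [psi x = expR (- x) - 1 + x]. *)
Lemma supersolution a c x : 0 <= x -> 0 <= c -> c * (2 * c - a) <= 0 ->
  2 * a - 4 * c <= 2 / 3 ->
  2 * (expR (- x) - 1 + x) * (1 - c * x) ^+ 2 <=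
  (x - a * (expR (- x) - 1 + x)) * (x * (2 - c * x)) - x ^+ 2 * (1 - c * x).
Proof.
move=> x0 c0 ca aca; have psi0 : 0 <= expR (- x) - 1 + x.
  by have := expR_ge1Dx (- x); lra.
have := expR_sub_affine_le x0; move: (expR (- x) - 1 + x) psi0 => psi psi0 h1.
have h2 : psi * ((2 * a - 4 * c) * x) <= psi * (2 / 3 * x).
  by rewrite ler_wpM2l// ler_wpM2r.
have h3 : psi * (c * (2 * c - a) * x ^+ 2) <= 0.
  by rewrite mulr_ge0_le0// mulr_le0_ge0// sqr_ge0.
rewrite -subr_ge0 (_ : _ - _ = x ^+ 2 - psi * (2 + 2 / 3 * x) +
  (psi * (2 / 3 * x) - psi * ((2 * a - 4 * c) * x)) -
  psi * (c * (2 * c - a) * x ^+ 2)); last by field.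
lra.
Qed.

(** Dividing by the Laplace transform [N], and then centering at the mean
    [mu], turns the entropy inequality into a linear one for the logarithm of
    the Laplace transform. *)
Lemma entropy_normalize (x N dN psi g a b : R) : 0 < N ->
  x * dN - N * g <= psi * (a * dN + b * N) ->
  x * (N^-1 * dN) - g <= psi * (a * (N^-1 * dN) + b).
Proof.
move=> N0 ent; rewrite -(ler_pM2l N0).
have -> : N * (x * (N^-1 * dN) - g) = x * dN - N * g by field; rewrite gt_eqF.
have -> : N * (psi * (a * (N^-1 * dN) + b)) = psi * (a * dN + b * N).
  by field; rewrite gt_eqF.
exact: ent.
Qed.

Lemma entropy_recenter (x psi g a b m mu : R) :
  x * m - g <= psi * (a * m + b) ->
  (x - a * psi) * (m - mu) - (g - x * mu) <= (a * mu + b) * psi.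
Proof. by move=> ent; lra. Qed.

Lemma is_derive_expansion (F : R -> R) (x dF kappa : R) :
  is_derive x 1 F dF -> 0 < kappa ->
  exists2 delta, 0 < delta & forall h, `|h| < delta ->
    `|F (x + h) - F x - h * dF| <= kappa * `|h|.
Proof.
move=> hF k0.
have cF : h^-1 *: (F (h *: 1 + x) - F x) @[h --> 0^'] --> dF.
  have := @ex_derive _ _ _ _ _ _ _ hF; rewrite /derivable => cF.
  by have := @derive_val _ _ _ _ _ _ _ hF; rewrite /derive => <-.
move/cvgrPdist_le : cF => /(_ _ k0) /= [delta d0 hd].
exists delta => // h hdelta.
have [->|hn0] := eqVneq h 0.
  by rewrite addr0 mul0r subr0 subrr normr0 mulr0.
have := hd h; rewrite /ball_ /= sub0r normrN => /(_ hdelta hn0).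
rewrite /GRing.scale /= mulr1 addrC => h1.
have hp : 0 < `|h| by rewrite normr_gt0.
have -> : F (x + h) - F x - h * dF = - (h * (- (h^-1 * (F (x + h) - F x)) + dF)).
  by field.
by rewrite normrN normrM [leRHS]mulrC ler_pM2l// [x + h]addrC.
Qed.

(** A comparison principle at a singular point. The last hypothesis
    says that [q x = D x / x] satisfies [B * q x <= q' x] wherever it is
    negative, and [q] tends to [0] at [0]. Minimizing
    [D x / x * expR (- (B + 1) * x)] away from [0] thus excludes negative
    values, since the derivative at a negative minimum would be positive. *)
Lemma comparison_at0 (D dD : R -> R) (l B : R) : 0 < l -> 0 <= B ->
  D 0 = 0 -> is_derive (0 : R) 1 D 0 ->
  (forall x : R, 0 < x <= l -> is_derive x 1 D (dD x)) ->
  (forall x, 0 < x <= l -> D x < 0 -> B * x * D x <= x * dD x - D x) ->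
  0 <= D l.
Proof.
move=> l0 B0 D0 dD0 hD key; rewrite leNgt; apply/negP => Dl.
pose E x := expR (- (B + 1) * x).
pose p x := D x * x^-1 * E x.
pose dp x := (dD x * x^-1 + D x * (- 1 / x ^+ 2)) * E x +
  D x * x^-1 * (E x * (- (B + 1) * 1)).
have hp (x : R) : 0 < x <= l -> is_derive x 1 p (dp x).
  move=> xl; have x0 : x != 0 by have /andP[x0 _] := xl; rewrite gt_eqF.
  have d1 := is_derive_mulf (hD x xl) (is_derive_invf x0 (is_derive_idf x)).
  have d2 := is_derive_expRf (is_derive_scalef (- (B + 1)) (is_derive_idf x)).
  exact: (is_derive_mulf d1 d2).
have p_sign (x : R) : 0 < x -> (p x < 0) = (D x < 0).
  by move=> x0; rewrite /p pmulr_llt0 ?expR_gt0// pmulr_llt0// invr_gt0.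
have dp_gt0 (x : R) : 0 < x <= l -> p x < 0 -> 0 < dp x.
  move=> xl; have /andP[x0 _] := xl; rewrite p_sign// => Dx.
  have -> : dp x = E x * ((x * dD x - D x - B * x * D x) / x ^+ 2 + (- D x) / x).
    by rewrite /dp; field; rewrite gt_eqF.
  rewrite mulr_gt0 ?expR_gt0// ltr_wpDl//.
    by rewrite divr_ge0 ?sqr_ge0// subr_ge0; exact: key.
  by rewrite divr_gt0// oppr_gt0.
have pl : p l < 0 by rewrite p_sign.
have pl0 : 0 < - p l by rewrite oppr_gt0.
have [delta delta0 hdelta] := is_derive_expansion dD0 (divr_gt0 pl0 (ltr0Sn R 1)).
pose eps := Num.min (delta / 2) (l / 2).
have eps0 : 0 < eps by rewrite lt_min !divr_gt0.
have epsl : eps < l by rewrite gt_min; apply/orP; right; lra.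
have epsd : eps < delta by rewrite gt_min; apply/orP; left; lra.
(* Near [0] the quotient [D x / x] exceeds the negative value [p l]. *)
have peps : p l < p eps.
  have := hdelta eps; rewrite gtr0_norm// => /(_ epsd).
  rewrite add0r D0 subr0 mulr0 subr0 => hDe.
  have h1 : `|D eps / eps| <= - p l / 2.
    by rewrite normrM normfV (gtr0_norm eps0) ler_pdivrMr.
  have h2 : `|p eps| <= - p l / 2.
    rewrite /p normrM (le_trans _ h1)// ler_piMr// ger0_norm ?expR_ge0//.
    by rewrite -expR0 ler_expR mulNr oppr_le0; apply: mulr_ge0; [lra|exact: ltW].
  by move: h2; rewrite ler_norml => /andP[h2 _]; lra.
have cp : {within `[eps, l], continuous p}.
  apply: derivable_within_continuous => x; rewrite in_itv /= => /andP[ex xl].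
  have h : is_derive x 1 p (dp x) by apply: hp; rewrite xl (lt_le_trans eps0).
  exact: ex_derive.
have [m] := EVT_min (ltW epsl) cp; rewrite in_itv /= => /andP[em ml] minm.
have pml : p m <= p l by apply: minm; rewrite in_itv /= (ltW epsl) lexx.
have pm0 : p m < 0 by exact: le_lt_trans pml pl.
have m0 : 0 < m by exact: lt_le_trans em.
have mint : 0 < m <= l by rewrite m0.
have em' : eps < m.
  rewrite lt_neqAle em andbT; apply/eqP => e.
  by move: peps; rewrite e ltNge pml.
have dpm := dp_gt0 m mint pm0.
have [delta' delta'0 hdelta'] := is_derive_expansion (hp m mint)
  (divr_gt0 dpm (ltr0Sn R 1)).
(* As [p] has a positive derivative at [m], it is smaller to the left of [m]. *)
pose h := Num.min (delta' / 2) (m - eps).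
have h0 : 0 < h by rewrite lt_min divr_gt0//= subr_gt0.
have hd : h < delta' by rewrite gt_min; apply/orP; left; lra.
have hme : h <= m - eps by rewrite ge_min lexx orbT.
have := hdelta' (- h); rewrite normrN gtr0_norm// => /(_ hd).
have : p m <= p (m - h).
  by apply: minm; rewrite in_itv /=; apply/andP; split; lra.
rewrite ler_norml => h1 /andP[_ h2].
have h3 : 0 < dp m * h by rewrite mulr_gt0.
by move: h2; rewrite mulNr opprK mulrAC [h * _]mulrC; lra.
Qed.

(** The differential inequality satisfied by a function with value [G] and
    slope [dG], against the supersolution with value [v * s] and slope
    [v * ds], yields the hypothesis of [comparison_at0]. The constant
    [a / (1 - c * lam)] comes from the lower bound
    [x * (1 - c * lam) <= 2 * L] for the coefficient [L] of the slope. *)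
Lemma comparison_step a c lam x psi v G dG (k := 1 - c * x)
    (s := x ^+ 2 * (2 * k)^-1) (ds := x * (2 - c * x) / (2 * k ^+ 2)) :
  0 <= a -> 0 <= c -> c * lam < 1 -> 0 < x <= lam -> 0 <= v ->
  0 <= psi <= x ^+ 2 / 2 ->
  2 * psi * k ^+ 2 <= (x - a * psi) * (x * (2 - c * x)) - x ^+ 2 * k ->
  (x - a * psi) * dG - G <= v * psi ->
  v * s - G < 0 ->
  a / (1 - c * lam) * x * (v * s - G) <= x * (v * ds - dG) - (v * s - G).
Proof.
move=> a0 c0 clam /andP[x0 xl] v0 /andP[psi0 psi_le] sup diff.
have cxl : c * x <= c * lam by rewrite ler_wpM2l.
have k0 : 0 < k by rewrite /k; lra.
have cx0 : 0 <= c * x by rewrite mulr_ge0// ltW.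
have cl0 : 0 < 1 - c * lam by lra.
have kpsi : 0 <= 2 * psi * k ^+ 2 by apply: mulr_ge0; [exact: mulr_ge0|exact: sqr_ge0].
have xk0 : 0 < x ^+ 2 * k by rewrite mulr_gt0// exprn_gt0.
set L := x - a * psi in sup diff *.
have w0 : 0 < x * (2 - c * x) by rewrite mulr_gt0//; rewrite /k in k0; lra.
have L0 : 0 < L by rewrite -(pmulr_lgt0 L w0); lra.
have L_ge : x * (1 - c * lam) <= 2 * L.
  have h1 : x * k <= L * (2 - c * x).
    rewrite -(ler_pM2l x0) mulrA -expr2 [x * (L * _)]mulrCA.
    by lra.
  have h2 : L * (2 - c * x) <= L * 2 by rewrite ler_pM2l//; lra.
  have h3 : x * (1 - c * lam) <= x * k by rewrite ler_pM2l// /k; lra.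
  lra.
have slopeD : v * s - G <= L * (v * ds - dG).
  have h1 : v * psi <= v * (L * ds - s).
    rewrite ler_wpM2l// -subr_ge0.
    have -> : L * ds - s - psi =
        (L * (x * (2 - c * x)) - x ^+ 2 * k - 2 * psi * k ^+ 2) / (2 * k ^+ 2).
      by rewrite /ds /s; field; rewrite gt_eqF.
    by rewrite divr_ge0 ?subr_ge0// mulr_ge0// sqr_ge0.
  rewrite mulrBr (mulrCA L v ds).
  move: h1; rewrite mulrBr; lra.
have BxL : a * psi <= a / (1 - c * lam) * x * L.
  have h1 : a * psi <= a * (x ^+ 2 / 2) by rewrite ler_wpM2l.
  apply: le_trans h1 _.
  have -> : a * (x ^+ 2 / 2) = a / (1 - c * lam) * x * (x * (1 - c * lam) / 2).
    by field; rewrite gt_eqF.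
  rewrite ler_wpM2l//; last by lra.
  by rewrite mulr_ge0 ?(ltW x0)// divr_ge0// ltW.
move: (v * s - G) (v * ds - dG) slopeD => D dD slopeD D0.
move: (a / (1 - c * lam)) BxL => B BxL.
rewrite -(ler_pM2l L0) -subr_ge0.
have -> : L * (x * dD - D) - L * (B * x * D) =
    x * (L * dD - D) + (- D) * (B * x * L - a * psi).
  by rewrite /L; ring.
by rewrite addr_ge0// mulr_ge0// ?subr_ge0// ?oppr_ge0// ltW.
Qed.

End calculus.

(** * The upper tail *)

Section upper_tail.
Context {R : realType} {d : measure_display} {X : measurableType d} {n : nat}.
Variables (nu : probability (n.-tuple X) R) (a b c : R).
Variables (f : n.-tuple X -> R) (fi : 'I_n -> n.-tuple X -> R).
Hypothesis nuR : resampling_invariant nu.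
Hypothesis sb : unit_self_bounding a b f fi.
Hypotheses (a_ge0 : 0 <= a) (c_ge0 : 0 <= c).
Hypotheses (c_le : c * (2 * c - a) <= 0) (c_ge : 2 * a - 4 * c <= 2 / 3).

Local Notation mu := (\int[nu]_x f x).
Hypothesis v_ge0 : 0 <= a * mu + b.

Let bf : bounded_mfun f. Proof. by have [] := sb. Qed.

(** The logarithm of the centered Laplace transform vanishes to second order
    at [0], as does the supersolution, so [comparison_at0] compares them. *)
Lemma laplace_upper lam : 0 <= lam -> c * lam < 1 ->
  laplace nu f lam <=
  expR (lam * mu + (a * mu + b) * (lam ^+ 2 / (2 * (1 - c * lam)))).
Proof.
rewrite le_eqVlt => /predU1P[<- _|lam0 clam].
  by rewrite laplace0 expr0n /= !mul0r mulr0 addr0 expR0.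
pose v := a * mu + b.
pose m (x : R) := (laplace nu f x)^-1 * dlaplace nu f x.
pose D (x : R) := v * (x ^+ 2 * (2 * (1 - c * x))^-1) - (ln (laplace nu f x) - x * mu).
pose dD (x : R) := v * (x * (2 - c * x) / (2 * (1 - c * x) ^+ 2)) - (m x - mu).
have cx1 (x : R) : 0 <= x <= lam -> 0 < 1 - c * x.
  by move=> /andP[x0 xl]; rewrite subr_gt0 (le_lt_trans _ clam)// ler_wpM2l.
have hD (x : R) : 0 <= x <= lam -> is_derive x 1 D (dD x).
  move=> xl; have cx := cx1 x xl.
  have nz : 2 * (1 - c * x) != 0 by rewrite gt_eqF// mulr_gt0.
  have d1 := is_derive_scalef 2 (is_derive_subf (is_derive_cstf 1 x)
    (is_derive_scalef c (is_derive_idf x))).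
  have d2 := is_derive_mulf (is_derive_powf 2 (is_derive_idf x))
    (@is_derive_invf _ (fun y => 2 * (1 - c * y)) x _ nz d1).
  have d3 := is_derive_lnf (laplace_gt0 nu bf x) (is_derive_laplace nu bf x).
  have d4 := is_derive_subf d3 (is_derive_mulf (is_derive_idf x) (is_derive_cstf mu x)).
  apply: is_derive_eq (is_derive_subf (is_derive_scalef v d2) d4) _.
  have alg (A B w : R) : w * (2%:R * x * 1 * (2 * (1 - c * x))^-1 +
      x ^+ 2 * (- (2 * (0 - c * 1)) / (2 * (1 - c * x)) ^+ 2)) - (A - (1 * B + x * 0)) =
      w * (x * (2 - c * x) / (2 * (1 - c * x) ^+ 2)) - (A - B).
    by field; rewrite gt_eqF.
  exact: alg.
have D0 : D 0 = 0.
  by rewrite /D laplace0 ln1 expr0n /= !mul0r mulr0 subr0 subrr.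
have dD0 : is_derive (0 : R) 1 D 0.
  apply: is_derive_eq; first by apply: hD; rewrite lexx ltW.
  rewrite /dD /m laplace0 dlaplace0 invr1 mul1r !mul0r mulr0 subrr subr0.
  by [].
pose B := a / (1 - c * lam).
have clam0 : 0 < 1 - c * lam by rewrite subr_gt0.
have B0 : 0 <= B by rewrite divr_ge0// ltW.
have key (x : R) : 0 < x <= lam -> D x < 0 -> B * x * D x <= x * dD x - D x.
  move=> /andP[x0 xl].
  have xlam : 0 <= x <= lam by rewrite (ltW x0).
  have cx := cx1 x xlam.
  have ent := entropy_self_bounding nuR sb x.
  have sup := supersolution (ltW x0) c_ge0 c_le c_ge.
  have psi_le := expR_sub_affine_le_sqr (ltW x0).
  have psi_ge : 0 <= expR (- x) - 1 + x.
    by have := expR_ge1Dx (- x); rewrite addrC; lra.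
  have N0 := laplace_gt0 nu bf x.
  have {}ent : x * m x - ln (laplace nu f x) <=
      (expR (- x) - 1 + x) * (a * m x + b).
    exact: (entropy_normalize N0 ent).
  move=> Dx; apply: (comparison_step a_ge0 c_ge0 clam _ v_ge0 _ sup _ Dx).
  - by rewrite x0.
  - by rewrite psi_ge.
  exact: (entropy_recenter mu ent).
have : 0 <= D lam.
  apply: (comparison_at0 lam0 B0 D0 dD0 _ key) => x /andP[x0 xl].
  by apply: hD; rewrite ltW.
rewrite /D subr_ge0 lerBlDl => h1.
by rewrite -[leLHS]lnK ?ler_expR// posrE; exact: laplace_gt0.
Qed.

End upper_tail.

(** * Optimizing Chernoff's bound *)

Section exp_bound.
Context {R : realType}.
Implicit Types t v c den : R.

Lemma exp_bound_le t den den' : 0 <= den <= den' ->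
  exp_bound 1 t den <= exp_bound 1 t den'.
Proof.
move=> /andP[]; rewrite le_eqVlt /exp_bound => /predU1P[<- _|den0 denle].
  by rewrite eqxx; case: ifP => // _; exact: expR_ge0.
rewrite !gt_eqF ?(lt_le_trans den0)// ler_expR !divr1 !mulN1r lerN2.
by rewrite ler_wpM2l ?sqr_ge0// lef_pV2 ?posrE// (lt_le_trans den0).
Qed.

Lemma exp_bound_scale (M t den : R) : 0 < M ->
  exp_bound M (M * t) (M * den) = exp_bound 1 t den.
Proof.
move=> M0; rewrite /exp_bound mulf_eq0 (gt_eqF M0) /=.
have [//|den0] := eqVneq den 0; congr expR.
by field; rewrite den0 gt_eqF.
Qed.

(** For positive [v] the best [lam] is [t / (v + c * t)]; for [v = 0] it would
    be the excluded endpoint [c^-1], and half of it is already good enough. *)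
Lemma chernoff_optimum (p v c t : R) : 0 <= v -> 0 <= c -> 0 < t ->
  (forall lam, 0 <= lam -> c * lam < 1 ->
    p <= expR (- (lam * t) + v * (lam ^+ 2 / (2 * (1 - c * lam))))) ->
  p <= exp_bound 1 t (2 * v + 2 * c * t).
Proof.
move=> v0 c0 t0 hp; have ct0 : 0 <= c * t by rewrite mulr_ge0// ltW.
rewrite /exp_bound; case: ifPn => [/eqP den0|den_neq0].
  have ve : v = 0 by lra.
  have ce : c = 0.
    by apply/eqP; rewrite -[_ == 0]orbF -(gt_eqF t0) -mulf_eq0; apply/eqP; lra.
  rewrite leNgt; apply/negP => p0.
  have := hp (p * t)^-1; rewrite ve ce !mul0r addr0.
  have pt0 : 0 <= (p * t)^-1 by rewrite invr_ge0 mulr_ge0// ltW.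
  move=> /(_ pt0 ltr01); have -> : (p * t)^-1 * t = p^-1.
    by field; rewrite !gt_eqF.
  have h1 := expR_ge1Dx p^-1.
  have h2 : p * (1 + p^-1) <= p * expR p^-1 by rewrite ler_pM2l.
  move=> h3; have : p * expR p^-1 <= expR (- p^-1) * expR p^-1.
    by rewrite ler_pM2r// expR_gt0.
  rewrite -expRD addNr expR0 => h4.
  have := le_trans h2 h4; rewrite mulrDr mulr1 divff ?gt_eqF//; lra.
move: v0; rewrite le_eqVlt => /predU1P[ve|v0].
  have c_gt0 : 0 < c.
    rewrite lt_neqAle c0 andbT eq_sym; apply: contra den_neq0 => /eqP ->.
    by rewrite -ve !mulr0 mul0r addr0.
  apply: le_trans (hp (2 * c)^-1 _ _) _.
  - by rewrite invr_ge0; lra.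
  - rewrite (_ : c * (2 * c)^-1 = 2^-1); last by field; rewrite gt_eqF.
    by lra.
  rewrite ler_expR -ve mul0r addr0 le_eqVlt; apply/orP; left; apply/eqP.
  by field; rewrite !gt_eqF.
have vct : 0 < v + c * t by lra.
apply: le_trans (hp (t / (v + c * t)) _ _) _.
- by rewrite divr_ge0// ltW.
- by rewrite mulrA ltr_pdivrMr// mul1r; lra.
rewrite ler_expR le_eqVlt; apply/orP; left; apply/eqP.
by field; rewrite !gt_eqF//; lra.
Qed.

End exp_bound.

Section unit_tails.
Context {R : realType} {d : measure_display} {X : measurableType d} {n : nat}.
Variables (nu : probability (n.-tuple X) R) (a b : R).
Variables (f : n.-tuple X -> R) (fi : 'I_n -> n.-tuple X -> R).
Hypothesis nuR : resampling_invariant nu.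
Hypothesis sb : unit_self_bounding a b f fi.
Hypotheses (f_ge0 : forall x, 0 <= f x) (a_ge0 : 0 <= a) (b_ge0 : 0 <= b).

Local Notation mu := (\int[nu]_x f x).

Let bf : bounded_mfun f. Proof. by have [] := sb. Qed.
Let v_ge0 : 0 <= a * mu + b.
Proof. by rewrite addr_ge0// mulr_ge0//; exact: Rintegral_ge0. Qed.

Let nuE (A : set (n.-tuple X)) : measurable A -> nu A = (fine (nu A))%:E.
Proof. by move=> mA; rewrite fineK// fin_num_measure. Qed.

Let measurable_ge (g : n.-tuple X -> R) c : measurable_fun [set: n.-tuple X] g ->
  measurable [set x | c <= g x].
Proof.
move=> mg; rewrite (_ : [set x | _] = g @^-1` `[c, +oo[).
  by rewrite -[X in measurable X]setTI; exact: mg.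
by apply/seteqP; split => x /=; rewrite in_itv /= andbT.
Qed.

(** [c = Num.max 0 (a - 3^-1) / 2] is the smallest nonnegative constant
    satisfying [2 * a - 4 * c <= 2 / 3], the condition of [supersolution]. *)
Lemma unit_upper_tail t : 0 < t ->
  (nu [set x | (t <= f x - mu)%R] <=
   (exp_bound 1 t (2 * (a * mu + b) + Num.max 0 (a - 3^-1) * t))%:E)%E.
Proof.
move=> t0; have mA : measurable [set x | t <= f x - mu].
  apply: measurable_ge; have [] := bounded_mfunB bf (bounded_mfun_cst mu).
  by [].
rewrite nuE// lee_fin; pose c := Num.max 0 (a - 3^-1) / 2.
have c0 : 0 <= c by rewrite divr_ge0// le_max lexx.
have [cle cge] : c * (2 * c - a) <= 0 /\ 2 * a - 4 * c <= 2 / 3.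
  rewrite /c; case: (leP 0 (a - 3^-1)) => h.
    split; last by lra.
    by rewrite mulr_ge0_le0//; lra.
  by split; lra.
have -> : Num.max 0 (a - 3^-1) = 2 * c by rewrite /c; field.
apply: chernoff_optimum => // lam lam0 clam.
rewrite -lee_fin -nuE//.
apply: (@le_trans _ _ (nu [set x | lam * (t + mu) <= lam * f x])).
  apply: le_measure; rewrite ?inE//.
    by apply: measurable_ge; have [] := bounded_mfunZ lam bf.
  by move=> x /= h; rewrite ler_wpM2l//; lra.
apply: le_trans (chernoff_laplace nu bf lam (lam * (t + mu))) _.
rewrite lee_fin.
have := ler_wpM2l (expR_ge0 (- (lam * (t + mu))))
  (laplace_upper nuR sb a_ge0 c0 cle cge v_ge0 lam0 clam).
move/le_trans; apply; rewrite -expRD ler_expR le_eqVlt; apply/orP; left.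
by apply/eqP; rewrite mulrDr opprD addrA subrK.
Qed.

Lemma unit_lower_tail t : 0 < t ->
  (nu [set x | (f x - mu <= - t)%R] <= (exp_bound 1 t (2 * (a * mu + b)))%:E)%E.
Proof.
move=> t0; have mA : measurable [set x | f x - mu <= - t].
  rewrite (_ : [set x | _] = [set x | t <= -1 * f x + mu]).
    apply: measurable_ge.
    by have [] := bounded_mfunD (bounded_mfunZ (-1) bf) (bounded_mfun_cst mu).
  by apply/seteqP; split => x /=; rewrite mulN1r => h; lra.
rewrite nuE// lee_fin.
(* [chernoff_optimum] with [c = 0]. *)
have -> : 2 * (a * mu + b) = 2 * (a * mu + b) + 2 * 0 * t by rewrite mulr0 mul0r addr0.
apply: chernoff_optimum => // lam lam0 _.
rewrite -lee_fin -nuE//.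
apply: (@le_trans _ _ (nu [set x | lam * (t - mu) <= - lam * f x])).
  apply: le_measure; rewrite ?inE//.
    by apply: measurable_ge; have [] := bounded_mfunZ (- lam) bf.
  by move=> x /= h; rewrite mulNr -mulrN ler_wpM2l//; lra.
apply: le_trans (chernoff_laplace nu bf (- lam) (lam * (t - mu))) _.
rewrite lee_fin.
have := ler_wpM2l (expR_ge0 (- (lam * (t - mu))))
  (laplace_lower nuR sb f_ge0 a_ge0 b_ge0 lam0).
move/le_trans; apply; rewrite -expRD ler_expR le_eqVlt; apply/orP; left.
by apply/eqP; rewrite mul0r subr0 mulr1 mulrBr opprB -mulrA; ring.
Qed.

End unit_tails.

(** * The law of a tuple of independent variables *)

Section boxes.
Context {d : measure_display} {X : measurableType d} {n : nat}.

Definition box (A : 'I_n -> set X) : set (n.-tuple X) :=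
  [set x | forall i, A i (tnth x i)].

Lemma measurable_box (A : 'I_n -> set X) :
  (forall i, measurable (A i)) -> measurable (box A).
Proof.
move=> mA; rewrite (_ : box A = \bigcap_(i in [set: 'I_n]) ((@tnth n X ^~ i) @^-1` A i)).
  apply: fin_bigcap_measurable => // i _; rewrite -[X in measurable X]setTI.
  exact: measurable_tnth.
by apply/seteqP; split => [x h i _|x h i]; exact: h.
Qed.

Definition boxes : set (set (n.-tuple X)) :=
  [set B | exists2 A : 'I_n -> set X, (forall i, measurable (A i)) & B = box A].

Lemma boxes_setI : setI_closed boxes.
Proof.
move=> _ _ [A mA ->] [B mB ->]; exists (fun i => A i `&` B i).
  by move=> i; exact: measurableI.
by apply/seteqP; split => [x [h1 h2] i|x h]; [split; [exact: h1|exact: h2]|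
  split => i; have [] := h i].
Qed.

Lemma boxes_setT : boxes [set: n.-tuple X].
Proof. by exists (fun=> [set: X]) => //; apply/seteqP; split. Qed.

Lemma measurable_boxes : measurable = <<s boxes >> :> set (set (n.-tuple X)).
Proof.
apply/seteqP; split; last first.
  apply: smallest_sub; first exact: sigma_algebra_measurable.
  by move=> _ [A mA ->]; exact: measurable_box.
apply: smallest_sub; first exact: smallest_sigma_algebra.
rewrite -bigcup_seq; apply: bigcup_sub => i _ _ [A mA <-].
apply: sub_sigma_algebra; exists (fun j => if j == i then A else [set: X]).
  by move=> j; case: ifP.
apply/seteqP; split => x /= => [[_ Ax] j|h].
  by case: eqP => // ->.
by split => //; have := h i; rewrite eqxx.
Qed.

Lemma boxes_unique (R : realType) (m1 m2 : probability (n.-tuple X) R) :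
  (forall A : 'I_n -> set X, (forall i, measurable (A i)) ->
    m1 (box A) = m2 (box A)) ->
  forall B, measurable B -> m1 B = m2 B.
Proof.
move=> m12 B; apply: (measure_unique boxes (fun=> [set: n.-tuple X])
  measurable_boxes boxes_setI (fun=> boxes_setT)).
- by rewrite bigcup_const//; exists 0%N.
- by move=> _ [A mA ->]; exact: m12.
- by move=> _; rewrite [ltLHS]probability_setT ltry.
Qed.

End boxes.

Definition joint (R : realType) (dO : measure_display) (Omega : measurableType dO)
    (P : probability Omega R) (dX : measure_display) (X : measurableType dX)
    (n : nat) (V : 'I_n -> {RV P >-> X}) (w : Omega) : n.-tuple X :=
  [tuple V i w | i < n].

Section joint.
Context {R : realType} {dO : measure_display} {Omega : measurableType dO}.
Context {P : probability Omega R} {dX : measure_display} {X : measurableType dX}.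
Context {n : nat} (V : 'I_n -> {RV P >-> X}).

Lemma measurable_joint : measurable_fun [set: Omega] (joint V).
Proof.
apply/measurable_fun_tnthP => i.
rewrite (_ : _ \o _ = V i); first exact: measurable_funPT.
by apply/funext => w; rewrite /= tnth_mktuple.
Qed.

HB.instance Definition _ := isMeasurableFun.Build _ _ _ _ (joint V) measurable_joint.

Definition joint_law : probability (n.-tuple X) R := distribution P (joint V).

Lemma mean_joint_law (F : n.-tuple X -> R) : bounded_mfun F ->
  \int[joint_law]_x F x = \int[P]_w F (joint V w).
Proof.
move=> bF; rewrite /Rintegral /joint_law integral_distribution//.
  by apply/measurable_EFinP; have [] := bF.
exact: (bounded_mfun_integrable P (bounded_mfun_comp measurable_joint bF)).
Qed.

Hypothesis hV : mutually_independent V.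

(** On a box, both laws give the product of the marginal probabilities; boxes
    generate the product sigma-algebra and are stable under intersection. *)
Lemma joint_law_resampling : resampling_invariant joint_law.
Proof.
move=> i F bF.
pose nu := joint_law.
pose phi (z : n.-tuple X * n.-tuple X) := mix [set~ i]%SET z.1 z.2.
have mphi : measurable_fun [set: n.-tuple X * n.-tuple X] phi.
  exact: measurable_mix.
pose phim : {mfun (n.-tuple X * n.-tuple X)%type >-> n.-tuple X} :=
  mfun_Sub (mem_set mphi).
pose m2 : probability (n.-tuple X) R := distribution (nu \x nu)%E phim.
have lawE (J : {set 'I_n}) (A : 'I_n -> set X) : (forall j, measurable (A j)) ->
    nu [set x | forall j, j \in J -> A j (tnth x j)] =
    (\prod_(j in J) P (V j @^-1` A j))%E.
  move=> mA; rewrite -hV//; congr (P _); apply/seteqP; split => w /= h j jJ.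
    by have := h j jJ; rewrite tnth_mktuple.
  by rewrite tnth_mktuple; exact: h.
have nu_m2 (B : set (n.-tuple X)) : measurable B -> nu B = m2 B.
  apply: boxes_unique => A mA.
  pose J := [set~ i]%SET.
  pose A1 := [set x : n.-tuple X | forall j, j \in J -> A j (tnth x j)].
  pose A2 := [set x : n.-tuple X | A i (tnth x i)].
  have mA1 : measurable A1.
    rewrite (_ : A1 = box (fun j => if j \in J then A j else [set: X])).
      by apply: measurable_box => j; case: ifP.
    apply/seteqP; split => x /= h j; first by case: ifP => //; exact: h.
    by move=> jJ; have := h j; rewrite jJ.
  have mA2 : measurable A2.
    by rewrite -[A2]setTI; exact: (measurable_tnth i).
  have -> : m2 (box A) = (nu \x nu)%E (A1 `*` A2).
    congr ((nu \x nu)%E _); apply/seteqP; split => -[x y] /=.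
      move=> h; split => [j jJ|]; last first.
        by have := h i; rewrite tnth_mix finset.in_setC1 eqxx.
      by have := h j; rewrite tnth_mix jJ.
    move=> [h1 h2] j; rewrite tnth_mix; case: ifPn => [|]; first exact: h1.
    by rewrite finset.in_setC1 negbK => /eqP ->.
  have -> : (nu \x nu)%E (A1 `*` A2) = (nu A1 * nu A2)%E.
    exact: product_measure1E.
  have -> : nu A1 = (\prod_(j in J) P (V j @^-1` A j))%E by exact: lawE.
  have -> : nu A2 = P (V i @^-1` A i).
    by congr (P _); apply/seteqP; split => w; rewrite /A2 /= tnth_mktuple.
  have -> : nu (box A) = (\prod_(j in [set: 'I_n]%SET) P (V j @^-1` A j))%E.
    rewrite -(lawE [set: 'I_n]%SET A mA); congr (nu _); apply/seteqP; split => x h j; first by [].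
    by apply: h; rewrite finset.in_setT.
  rewrite (bigD1 i) ?finset.in_setT//= muleC; congr (_ * _)%E.
  by apply: eq_bigl => j; rewrite finset.in_setT finset.in_setC1.
have bFphi : bounded_mfun (F \o phi) by exact: bounded_mfun_comp.
transitivity (\int[m2]_x F x).
  by congr fine; apply: eq_measure_integral => B mB _; exact: nu_m2.
rewrite (mean_prod nu nu bFphi) /Rintegral /m2 integral_distribution//.
  by apply/measurable_EFinP; have [] := bF.
exact: bounded_mfun_integrable.
Qed.

End joint.

(** * Reduction to unit increments *)

(** Move from [x0] by changing the coordinates one after the other. *)
Lemma bounded_coordinate_variation (R : realType) (X : Type) n
    (f : n.-tuple X -> R) (M : R) (x0 : n.-tuple X) :
  (forall i x y, agree_off i x y -> f x - f y <= M) ->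
  forall x, f x <= f x0 + n%:R * M.
Proof.
move=> fM x.
suff step k : (k <= n)%N ->
    f (mix [set j : 'I_n | (j < k)%N]%SET x x0) <= f x0 + k%:R * M.
  have := step n (leqnn n); rewrite (_ : [set _ | _]%SET = [set: 'I_n]%SET) ?mix_setT//.
  by apply/setP => j; rewrite !inE ltn_ord.
elim: k => [_|k IH kn].
  rewrite (_ : [set _ | _]%SET = finset.set0).
    by rewrite mix_set0 mul0r addr0.
  by apply/setP => j; rewrite !inE.
have := fM (Ordinal kn) (mix [set j : 'I_n | (j < k.+1)%N]%SET x x0)
  (mix [set j : 'I_n | (j < k)%N]%SET x x0).
have agree : agree_off (Ordinal kn) (mix [set j : 'I_n | (j < k.+1)%N]%SET x x0)
    (mix [set j : 'I_n | (j < k)%N]%SET x x0).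
  by move=> j jk; rewrite !tnth_mix !inE ltnS leq_eqVlt (negbTE jk : (_ == k) = false).
move=> /(_ agree); have := IH (ltnW kn).
by rewrite -natr1 mulrDl mul1r; lra.
Qed.

Section coordinate_infimum.
Context {R : realType} {d : measure_display} {X : measurableType d} {n : nat}.
Implicit Types (f : n.-tuple X -> R) (i : 'I_n).

Lemma insensitive_omit_coord i : insensitive i (@omit_coord X n i).
Proof.
move=> x y xy; apply: eq_from_tnth => j; rewrite !tnth_mktuple; apply: xy.
by rewrite eq_sym neq_lift.
Qed.

Lemma measurable_omit_coord i :
  measurable_fun [set: n.-tuple X] (@omit_coord X n i).
Proof.
apply/measurable_fun_tnthP => j.
rewrite (_ : _ \o _ = @tnth n X ^~ (lift i j)); first exact: measurable_tnth.
by apply/funext => x; rewrite /= tnth_mktuple.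
Qed.

Lemma self_bounding_unit (M a b : R) f : 0 < M -> (forall x, 0 <= f x) ->
  measurable_fun [set: n.-tuple X] f ->
  (forall i, measurable_fun [set: n.-1.-tuple X] (coord_inf f i)) ->
  n.-tuple X -> self_bounding M a b f ->
  unit_self_bounding a (M^-1 * b) (fun x => M^-1 * f x)
    (fun i x => M^-1 * coord_inf f i (omit_coord i x)).
Proof.
move=> M0 f0 mf mfi x0 sb.
pose fi i x := coord_inf f i (omit_coord i x).
have D01 i x : 0 <= f x - fi i x <= M by have [h _] := sb x; exact: h.
have variation i x y : agree_off i x y -> f x - f y <= M.
  move=> xy; have /andP[_ h1] := D01 i x; have /andP[h2 _] := D01 i y.
  by move: h1 h2; rewrite /fi (insensitive_omit_coord xy); lra.
have fB := bounded_coordinate_variation x0 variation.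
have bf : bounded_mfun f.
  by split => //; exists (f x0 + n%:R * M) => x; rewrite ger0_norm.
have bfi i : bounded_mfun (fi i).
  split; first exact: measurableT_comp (mfi i) (measurable_omit_coord i).
  exists (f x0 + n%:R * M + M) => x; have := D01 i x; have := fB x; have := f0 x.
  by move=> h1 h2 /andP[h3 h4]; rewrite ler_norml; apply/andP; split; lra.
split.
- exact: bounded_mfunZ.
- by move=> i; exact: (bounded_mfunZ _ (bfi i)).
- by move=> i x y xy; rewrite (insensitive_omit_coord xy).
- move=> i x; have /andP[h1 h2] := D01 i x; rewrite -mulrBr.
  by rewrite mulr_ge0 ?invr_ge0 ?(ltW M0)//= mulrC ler_pdivrMr// mul1r.
- move=> x; have [_ h] := sb x; under eq_bigr do rewrite -mulrBr.
  rewrite -mulr_sumr mulrCA -mulrDr ler_wpM2l// invr_ge0; exact: ltW.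
Qed.

End coordinate_infimum.

Lemma delta_plus_ge (R : realType) (a M : R) :
  Num.max 0 (a - 3^-1) <= delta_plus a M.
Proof.
rewrite /delta_plus; case: (lerP a 3^-1) => h.
  by rewrite ge_max lexx /=; lra.
have h1 : Num.max 0 (a - 3^-1) = a - 3^-1 by apply/max_idPr; lra.
by rewrite h1; do 2 (case: ifP => _ //); lra.
Qed.

Lemma delta_minus_ge0 (R : realType) (a : R) : 0 <= a -> 0 <= delta_minus a.
Proof. by rewrite /delta_minus; case: ifP. Qed.

Theorem theorem4 (R : realType)
  (dO : measure_display) (Omega : measurableType dO) (P : probability Omega R)
  (dX : measure_display) (X : measurableType dX)
  (M a b : R) (hM : 0 < M) (ha : 0 <= a) (hb : 0 <= b)
  (n : nat) (V : 'I_n -> {RV P >-> X}) (hV : mutually_independent V)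
  (f : n.-tuple X -> R)
  (f_ge0 : forall x, 0 <= f x)
  (f_meas : measurable_fun [set: n.-tuple X] f)
  (fi_meas : forall i : 'I_n, measurable_fun [set: n.-1.-tuple X] (coord_inf f i))
  (f_sb : self_bounding M a b f)
  (Z : Omega -> R) (hZ : Z = fun w => f [tuple V i w | i < n])
  (Z_mean : ('E_P[Z])%E \is a fin_num) :
  (forall t : R, 0 < t ->
     (P [set w | (t <= Z w - fine ('E_P[Z])%E)%R] <=
      (exp_bound M t
         (2 * (a * fine ('E_P[Z])%E + b) + delta_plus a M * t))%:E)%E) /\
  (forall t : R, 0 < t <= fine ('E_P[Z])%E ->
     (P [set w | (Z w - fine ('E_P[Z])%E <= - t)%R] <=
      (exp_bound M t
         (2 * (a * fine ('E_P[Z])%E + b) + delta_minus a * t))%:E)%E).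
Proof.
(* A probability space is inhabited, hence so are the tuples. *)
have [w0 _] : exists w0 : Omega, True.
  apply/not_existsP => noO; have := @probability_setT _ _ _ P.
  rewrite (_ : [set: Omega] = set0) ?measure0; last first.
    by apply/seteqP; split => // w _; exact: (noO w).
  by move/eqP; rewrite eqe eq_sym oner_eq0.
pose nu := joint_law V; pose g x := M^-1 * f x.
have Mg x : f x = M * g x by rewrite /g mulVKf// gt_eqF.
have sb : unit_self_bounding a (M^-1 * b) g
    (fun i x => M^-1 * coord_inf f i (omit_coord i x)).
  exact: self_bounding_unit hM f_ge0 f_meas fi_meas (joint V w0) f_sb.
have g_ge0 x : 0 <= g x by rewrite /g mulr_ge0// invr_ge0 ltW.
have bg : bounded_mfun g by have [] := sb.
have b'0 : 0 <= M^-1 * b by rewrite mulr_ge0// invr_ge0 ltW.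
have nuR : resampling_invariant nu by exact: joint_law_resampling.
pose mu := \int[nu]_x g x.
have muE : fine ('E_P[Z])%E = M * mu.
  rewrite /mu -meanZ// mean_joint_law; last exact: bounded_mfunZ.
  rewrite unlock hZ /Rintegral; congr fine; apply: eq_integral => w _.
  by rewrite -Mg.
rewrite muE; have v0 : 0 <= a * mu + M^-1 * b.
  by rewrite addr_ge0// mulr_ge0//; exact: Rintegral_ge0.
have scale t delta : exp_bound M t (2 * (a * (M * mu) + b) + delta * t) =
    exp_bound 1 (M^-1 * t) (2 * (a * mu + M^-1 * b) + delta * (M^-1 * t)).
  rewrite -[RHS](exp_bound_scale _ _ hM); congr exp_bound; first by rewrite mulVKf ?gt_eqF.
  by field; rewrite gt_eqF.
split => t.
  move=> t0; have t'0 : 0 < M^-1 * t by rewrite mulr_gt0// invr_gt0.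
  rewrite scale; have := unit_upper_tail nuR sb g_ge0 ha b'0 t'0.
  rewrite (_ : nu _ = P [set w | t <= Z w - M * mu]); last first.
    by congr (P _); apply/seteqP; split => w /=;
      rewrite hZ Mg -mulrBr ler_pdivrMl.
  move/le_trans; apply; rewrite lee_fin; apply: exp_bound_le.
  apply/andP; split; last by rewrite lerD2l ler_wpM2r ?delta_plus_ge// ltW.
  apply: addr_ge0; apply: mulr_ge0 => //; last exact: ltW.
  by rewrite le_max lexx.
move=> /andP[t0 _]; have t'0 : 0 < M^-1 * t by rewrite mulr_gt0// invr_gt0.
rewrite scale; have := unit_lower_tail nuR sb g_ge0 ha b'0 t'0.
rewrite (_ : nu _ = P [set w | Z w - M * mu <= - t]); last first.
  by congr (P _); apply/seteqP; split => w /=;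
    rewrite hZ Mg -mulrBr -mulrN ler_pdivlMl.
move/le_trans; apply; rewrite lee_fin; apply: exp_bound_le.
rewrite lerDl; apply/andP; split; first by rewrite mulr_ge0.
by rewrite mulr_ge0 ?delta_minus_ge0// ltW.
Qed.
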